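(* Let $\mathbb{K}$ be an algebraically closed field of characteristic $0$ and let $\mathfrak{g}$ be a finite-dimensional simple Lie algebra over $\mathbb{K}$. Let $\mathfrak{g}\otimes\mathbb{K}((t))$ be the Lie algebra over $\mathbb{K}$ with bracket $[x\otimes r,y\otimes s]'=[x,y]\otimes rs$ for $x,y\in\mathfrak{g}$ and $r,s\in\mathbb{K}((t))$. Then $\mathfrak{g}\otimes\mathbb{K}((t))$ is an infinite-dimensional simple Lie algebra over $\mathbb{K}$, and $$\operatorname{H}^2(\mathfrak{g}\otimes\mathbb{K}((t)),\mathbb{K})\subsetneq\operatorname{HL}^2(\mathfrak{g}\otimes\mathbb{K}((t)),\mathbb{K}).$$
   Context: $\mathbb{K}((t))$ is the field of formal Laurent series over $\mathbb{K}$ and $\otimes=\otimes_{\mathbb{K}}$. For a Lie algebra $L$ over $\mathbb{K}$, $\operatorname{H}^2(L,\mathbb{K})$ is the second Chevalley--Eilenberg cohomology with trivial coefficients. $\operatorname{HL}^2(L,\mathbb{K})$ is the second Leibniz cohomology with trivial coefficients: the space of bilinear forms $\alpha$ on $L$ with $\alpha(x,[y,z])=\alpha([x,y],z)-\alpha([x,z],y)$ for all $x,y,z\in L$ (Leibniz $2$-cocycles), modulo those of the form $(x,y)\mapsto-\beta([x,y])$ with $\beta\in L^*$. $\operatorname{H}^2(L,\mathbb{K})$ is viewed as a subspace of $\operatorname{HL}^2(L,\mathbb{K})$ via the natural embedding, since every Lie $2$-cocycle is a Leibniz $2$-cocycle. *)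

(* Defs.v *)
From HB Require Import structures.
From mathcomp Require Import all_boot all_order all_algebra.
From mathcomp Require Import generic_quotient sesquilinear.
From mathcomp Require Import boolp classical_sets functions fsbigop.
From mathcomp Require Import ring.

Set Implicit Arguments.
Unset Strict Implicit.
Unset Printing Implicit Defensive.

Import Order.TTheory GRing.Theory Num.Theory.
Local Open Scope classical_set_scope.
Local Open Scope ring_scope.

HB.mixin Record isLieAlgebra (K : fieldType) L of GRing.Lmodule K L := {
  bracket : L -> L -> L;
  bracket_bilinear : bilinear_for *:%R *:%R bracket;
  bracketxx : forall x, bracket x x = 0;
  bracket_jacobi : forall x y z,
    bracket x (bracket y z) + bracket y (bracket z x)
    + bracket z (bracket x y) = 0
}.

#[short(type="lieAlgType")]
HB.structure Definition LieAlgebra (K : fieldType) :=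
  {L of isLieAlgebra K L & GRing.Lmodule K L}.

#[short(type="finLieAlgType")]
HB.structure Definition FinDimLieAlgebra (K : fieldType) :=
  {L of LieAlgebra K L & Vector K L}.

Reserved Notation "[ 'lie' x , y ]"
  (at level 0, x, y at level 99, format "[ 'lie'  x ,  y ]").
Notation "[ 'lie' x , y ]" := (bracket x y) : ring_scope.

Section LieTheory.
Variables (K : fieldType) (L : lieAlgType K).
Implicit Types (x y z : L) (I : set L).

Definition lie_ideal I :=
  [/\ I 0, forall a x y, I x -> I y -> I (a *: x + y)
    & forall x y, I y -> I [lie x, y]].

Definition lie_abelian := forall x y, [lie x, y] = 0.

Definition lie_simple :=
  ~ lie_abelian /\ forall I, lie_ideal I -> I = [set 0] \/ I = setT.

End LieTheory.

Arguments lie_abelian {K} L.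
Arguments lie_simple {K} L.

Definition finite_dimensional (K : fieldType) (V : lmodType K) :=
  exists n, inhabited (Vector.axiom n V).

Section LieElementary.
Variables (K : fieldType) (L : lieAlgType K).
Implicit Types x y z : L.

Lemma bracketPl a x y z :
  [lie a *: x + y, z] = a *: [lie x, z] + [lie y, z].
Proof. exact: (@bracket_bilinear K L).1. Qed.

Lemma bracketPr a x y z :
  [lie z, a *: x + y] = a *: [lie z, x] + [lie z, y].
Proof. exact: (@bracket_bilinear K L).2. Qed.

Lemma bracketDl x y z : [lie x + y, z] = [lie x, z] + [lie y, z].
Proof. by rewrite -[x]scale1r bracketPl !scale1r. Qed.

Lemma bracketDr x y z : [lie z, x + y] = [lie z, x] + [lie z, y].
Proof. by rewrite -[x]scale1r bracketPr !scale1r. Qed.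

Lemma bracket0l x : [lie 0, x] = 0.
Proof. by apply: (addrI [lie 0, x]); rewrite -bracketDl !addr0. Qed.

Lemma bracket0r x : [lie x, 0] = 0.
Proof. by apply: (addrI [lie x, 0]); rewrite -bracketDr !addr0. Qed.

Lemma bracketZl a x y : [lie a *: x, y] = a *: [lie x, y].
Proof. by rewrite -[a *: x]addr0 bracketPl bracket0l addr0. Qed.

Lemma bracketZr a x y : [lie x, a *: y] = a *: [lie x, y].
Proof. by rewrite -[a *: y]addr0 bracketPr bracket0r addr0. Qed.

Lemma bracketNr x y : [lie x, - y] = - [lie x, y].
Proof. by rewrite -scaleN1r bracketZr scaleN1r. Qed.

Lemma bracketC x y : [lie x, y] = - [lie y, x].
Proof.
apply/eqP; rewrite -addr_eq0; have := bracketxx (x + y).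
by rewrite bracketDl !bracketDr !bracketxx add0r addr0 => ->.
Qed.

End LieElementary.

Section Cohomology.
Variables (K : fieldType) (L : lieAlgType K).
Implicit Types (a : L -> L -> K) (b : L -> K) (x y z : L).

(* The Chevalley-Eilenberg differentials in degrees 1 and 2. *)
Definition ce_d1 b : L -> L -> K := fun x y => - b [lie x, y].

Definition ce_d2 a : L -> L -> L -> K := fun x y z =>
  - a [lie x, y] z + a [lie x, z] y - a [lie y, z] x.

Definition lie_cocycle2 : set (L -> L -> K) := [set a |
  [/\ bilinear_for *%R *%R a, forall x, a x x = 0
    & forall x y z, ce_d2 a x y z = 0]].

Definition leibniz_cocycle2 : set (L -> L -> K) := [set a |
  bilinear_for *%R *%R a /\
  forall x y z, a x [lie y, z] = a [lie x, y] z - a [lie x, z] y].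

(* The Lie 2-coboundaries and the Leibniz 2-coboundaries coincide. *)
Definition coboundary2 : set (L -> L -> K) :=
  [set ce_d1 b | b in [set b | scalar b]].

Definition cohomology_class a : set (L -> L -> K) :=
  [set (fun x y => a x y + c x y) | c in coboundary2].

(* H^2 and HL^2 are the quotients by coboundary2, whose elements are the
   cosets; the natural map H^2 -> HL^2 is therefore the identity on cosets. *)
Definition H2 : set (set (L -> L -> K)) :=
  [set cohomology_class a | a in lie_cocycle2].

Definition HL2 : set (set (L -> L -> K)) :=
  [set cohomology_class a | a in leibniz_cocycle2].

Lemma coboundary_lie_cocycle2 : coboundary2 `<=` lie_cocycle2.
Proof.
move=> _ [b blin <-]; have b0 : b 0 = 0.
  by apply: (addIr (b 0)); rewrite -{1}[b 0]mul1r -blin scaler0 addr0 add0r.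
have bD u v : b (u + v) = b u + b v by rewrite -[u]scale1r blin mul1r scale1r.
have bN u : b (- u) = - b u.
  by apply/eqP; rewrite -addr_eq0 -bD addNr b0.
split.
- split=> u' k u v /=; rewrite /applyr /ce_d1 ?bracketPl ?bracketPr blin;
  by rewrite opprD mulrN.
- by move=> x; rewrite /ce_d1 bracketxx b0 oppr0.
- move=> x y z; rewrite /ce_d2 /ce_d1 !opprK -bN -!bD -b0; congr (b _).
  rewrite (bracketC [lie x, z]) (bracketC x z) bracketNr opprK.
  rewrite (bracketC [lie x, y]) (bracketC [lie y, z]) -!opprD.
  rewrite -[RHS]oppr0 -(bracket_jacobi x y z).
  by congr (- _); rewrite addrC addrA addrAC.
Qed.

Lemma lie_leibniz_cocycle2 : lie_cocycle2 `<=` leibniz_cocycle2.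
Proof.
move=> a [abil axx da]; split=> // x y z.
have aDl u v w : a (u + v) w = a u w + a v w.
  by have := abil.1 w 1 u v; rewrite /= /applyr scale1r mul1r.
have aDr u v w : a w (u + v) = a w u + a w v.
  by have := abil.2 w 1 u v; rewrite /= scale1r mul1r.
have -> : a x [lie y, z] = - a [lie y, z] x.
  apply/eqP; rewrite -addr_eq0; have := axx (x + [lie y, z]).
  by rewrite aDl !aDr !axx add0r addr0 => ->.
by rewrite -[LHS]subr0 -(da x y z) /ce_d2 !opprD !opprK addrC addrK.
Qed.

Lemma H2_sub_HL2 : H2 `<=` HL2.
Proof. by move=> _ [a /lie_leibniz_cocycle2 aZ <-]; exists a. Qed.

End Cohomology.

Arguments H2 {K} L.
Arguments HL2 {K} L.

Section TensorProduct.
Local Open Scope quotient_scope.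
Variables (K : fieldType) (U V : lmodType K).

(* A sequence [:: (u1, v1); ...; (un, vn)] stands for the sum of the ui (x) vi.
   The relation is the congruence on the free commutative monoid on U * V
   generated by biadditivity, K-balancedness and 0 (x) v = 0; the last one turns
   the quotient monoid into a group, - (u (x) v) being (- u) (x) v. *)
Inductive tensor_eq : seq (U * V) -> seq (U * V) -> Prop :=
| tensor_refl s : tensor_eq s s
| tensor_sym s t : tensor_eq s t -> tensor_eq t s
| tensor_trans s t r : tensor_eq s t -> tensor_eq t r -> tensor_eq s r
| tensor_cat s s' t t' :
    tensor_eq s s' -> tensor_eq t t' -> tensor_eq (s ++ t) (s' ++ t')
| tensor_catC s t : tensor_eq (s ++ t) (t ++ s)
| tensor_addl u u' v : tensor_eq [:: (u + u', v)] [:: (u, v); (u', v)]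
| tensor_addr u v v' : tensor_eq [:: (u, v + v')] [:: (u, v); (u, v')]
| tensor_scale k u v : tensor_eq [:: (k *: u, v)] [:: (u, k *: v)]
| tensor_zero v : tensor_eq [:: (0, v)] [::].

Definition tensor_eqb s t := `[< tensor_eq s t >].

Lemma tensor_eqb_refl : reflexive tensor_eqb.
Proof. by move=> s; apply/asboolP; exact: tensor_refl. Qed.

Lemma tensor_eqb_sym : symmetric tensor_eqb.
Proof. by move=> s t; apply/asboolP/asboolP; exact: tensor_sym. Qed.

Lemma tensor_eqb_trans : transitive tensor_eqb.
Proof.
move=> t s r /asboolP st /asboolP tr; apply/asboolP.
exact: tensor_trans st tr.
Qed.

Canonical tensor_equiv :=
  EquivRel tensor_eqb tensor_eqb_refl tensor_eqb_sym tensor_eqb_trans.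

Definition tensor := {eq_quot tensor_eqb}.

HB.instance Definition _ : EqQuotient _ tensor_eqb tensor :=
  EqQuotient.on tensor.
HB.instance Definition _ := Choice.on tensor.

Definition tensor_of (s : seq (U * V)) : tensor := \pi_tensor s.

Definition tens (u : U) (v : V) : tensor := tensor_of [:: (u, v)].

Lemma tensor_ofP s t : tensor_of s = tensor_of t <-> tensor_eq s t.
Proof.
split=> [/eqmodP /asboolP //|st]; apply/eqmodP.
exact/asboolP.
Qed.

Lemma tensor_ofK x : tensor_of (repr x) = x.
Proof. exact: reprK. Qed.

Lemma repr_tensor_of s : tensor_eq (repr (tensor_of s)) s.
Proof. by apply/tensor_ofP; rewrite tensor_ofK. Qed.

Definition tensor_addop (x y : tensor) : tensor :=
  tensor_of (repr x ++ repr y).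

Definition tensor_opp (x : tensor) : tensor :=
  tensor_of [seq (- p.1, p.2) | p <- repr x].

Definition tensor_scaleop (k : K) (x : tensor) : tensor :=
  tensor_of [seq (k *: p.1, p.2) | p <- repr x].

Lemma tensor_of_cat s t :
  tensor_addop (tensor_of s) (tensor_of t) = tensor_of (s ++ t).
Proof. by apply/tensor_ofP/tensor_cat; exact: repr_tensor_of. Qed.

Lemma tensor_eq_map k s t : tensor_eq s t ->
  tensor_eq [seq (k *: p.1, p.2) | p <- s] [seq (k *: p.1, p.2) | p <- t].
Proof.
elim=> {s t} /=.
- by move=> s; exact: tensor_refl.
- by move=> s t _; exact: tensor_sym.
- by move=> s t r _ st _; exact: tensor_trans.
- by move=> s s' t t' _ ss _ tt; rewrite !map_cat; exact: tensor_cat.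
- by move=> s t; rewrite !map_cat; exact: tensor_catC.
- by move=> u u' v; rewrite scalerDr; exact: tensor_addl.
- by move=> u v v'; exact: tensor_addr.
- by move=> l u v; rewrite scalerA mulrC -scalerA; exact: tensor_scale.
- by move=> v; rewrite scaler0; exact: tensor_zero.
Qed.

Lemma tensor_of_scale k s :
  tensor_scaleop k (tensor_of s) = tensor_of [seq (k *: p.1, p.2) | p <- s].
Proof. by apply/tensor_ofP/tensor_eq_map; exact: repr_tensor_of. Qed.

Lemma tensor_oppE x : tensor_opp x = tensor_scaleop (-1) x.
Proof.
by congr tensor_of; apply: eq_map => -[u v] /=; rewrite scaleN1r.
Qed.

Lemma tensor_addA : associative tensor_addop.
Proof.
move=> x y z; rewrite -[x]tensor_ofK -[y]tensor_ofK -[z]tensor_ofK.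
by rewrite !tensor_of_cat catA.
Qed.

Lemma tensor_addC : commutative tensor_addop.
Proof. by move=> x y; apply/tensor_ofP; exact: tensor_catC. Qed.

Lemma tensor_add0 : left_id (tensor_of [::]) tensor_addop.
Proof. by move=> x; rewrite -[x]tensor_ofK tensor_of_cat. Qed.

Lemma tensor_addN : left_inverse (tensor_of [::]) tensor_opp tensor_addop.
Proof.
move=> x; rewrite tensor_oppE -[x]tensor_ofK; move: (repr x) => {x} s.
elim: s => [|[u v] s IHs]; first by rewrite tensor_of_scale tensor_of_cat.
rewrite -[(u, v) :: s]/([:: (u, v)] ++ s) -tensor_of_cat.
rewrite [in LHS]tensor_of_cat tensor_of_scale map_cat -2!tensor_of_cat.
rewrite -(tensor_of_scale _ s) tensor_addA -(tensor_addA _ _ (tensor_of [:: (u, v)])).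
rewrite [X in tensor_addop (tensor_addop _ X) _]tensor_addC tensor_addA.
rewrite -tensor_addA IHs [LHS]tensor_addC tensor_add0 tensor_of_cat /=.
apply/tensor_ofP; apply: tensor_trans (tensor_sym (tensor_addl _ _ _)) _.
by rewrite scaleN1r addNr; exact: tensor_zero.
Qed.

HB.instance Definition _ := GRing.isZmodule.Build tensor
  tensor_addA tensor_addC tensor_add0 tensor_addN.

Lemma tensor_ofD s t : tensor_of (s ++ t) = tensor_of s + tensor_of t.
Proof. by rewrite -tensor_of_cat. Qed.

Lemma tensor_ofE s : tensor_of s = \sum_(p <- s) tens p.1 p.2.
Proof.
elim: s => [|[u v] s IHs]; first by rewrite big_nil.
by rewrite big_cons -IHs -tensor_ofD.
Qed.

Lemma tensor_reprE x : x = \sum_(p <- repr x) tens p.1 p.2.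
Proof. by rewrite -tensor_ofE tensor_ofK. Qed.

Lemma tensor_scaleA k l x :
  tensor_scaleop k (tensor_scaleop l x) = tensor_scaleop (k * l) x.
Proof.
rewrite -[x]tensor_ofK !tensor_of_scale -map_comp; congr tensor_of.
by apply: eq_map => -[u v] /=; rewrite scalerA.
Qed.

Lemma tensor_scale1 : left_id 1 tensor_scaleop.
Proof.
move=> x; rewrite -[x]tensor_ofK tensor_of_scale; congr tensor_of.
by rewrite -[RHS]map_id; apply: eq_map => -[u v] /=; rewrite scale1r.
Qed.

Lemma tensor_scaleDr : right_distributive tensor_scaleop +%R.
Proof.
move=> k x y; rewrite -[x]tensor_ofK -[y]tensor_ofK -tensor_ofD.
by rewrite !tensor_of_scale map_cat tensor_ofD.
Qed.

Lemma tensor_scaleDl x : {morph tensor_scaleop^~ x : k l / k + l}.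
Proof.
move=> k l; rewrite -[x]tensor_ofK !tensor_of_scale !tensor_ofE !big_map.
rewrite -big_split; apply: eq_bigr => -[u v] _ /=; rewrite scalerDl.
by rewrite /tens -tensor_ofD; apply/tensor_ofP; exact: tensor_addl.
Qed.

HB.instance Definition _ := GRing.Zmodule_isLmodule.Build K tensor
  tensor_scaleA tensor_scale1 tensor_scaleDr tensor_scaleDl.

Lemma tens_bilinear : bilinear_for *:%R *:%R tens.
Proof.
have sE k u v : k *: tens u v = tens (k *: u) v by exact: tensor_of_scale.
split=> [v k u u'|u k v v'] /=; rewrite sE -tensor_ofD; apply/tensor_ofP.
  exact: tensor_addl.
apply: tensor_trans (tensor_addr _ _ _) _.
apply: (@tensor_cat [:: _] [:: _] [:: _] [:: _]); last exact: tensor_refl.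
exact/tensor_sym/tensor_scale.
Qed.

Section Lift.
Variables (W : lmodType K) (f : U -> V -> W).

Definition tensor_lift (x : tensor) : W := \sum_(p <- repr x) f p.1 p.2.

Hypothesis f_bilinear : bilinear_for *:%R *:%R f.

Let flin k u u' v : f (k *: u + u') v = k *: f u v + f u' v.
Proof. exact: f_bilinear.1. Qed.
Let frlin k u v v' : f u (k *: v + v') = k *: f u v + f u v'.
Proof. exact: f_bilinear.2. Qed.
Let f0l v : f 0 v = 0.
Proof.
by apply: (addIr (f 0 v)); rewrite -{1}[f 0 v]scale1r -flin scaler0 !add0r.
Qed.
Let f0r u : f u 0 = 0.
Proof.
by apply: (addIr (f u 0)); rewrite -{1}[f u 0]scale1r -frlin scaler0 !add0r.
Qed.

Lemma tensor_lift_of s : tensor_lift (tensor_of s) = \sum_(p <- s) f p.1 p.2.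
Proof.
rewrite /tensor_lift; move: (repr _) (repr_tensor_of s) => {}t.
elim=> {s t} //.
- by move=> s t r _ -> _ ->.
- by move=> s s' t t' _ + _; rewrite !big_cat /= => -> ->.
- by move=> s t; rewrite !big_cat /= addrC.
- by move=> u u' v; rewrite !big_cons !big_nil !addr0 -[u]scale1r flin !scale1r.
- by move=> u v v'; rewrite !big_cons !big_nil !addr0 -[v]scale1r frlin !scale1r.
- move=> k u v; rewrite !big_seq1 /= -[k *: u]addr0 -[k *: v]addr0.
  by rewrite flin frlin f0l f0r.
- by move=> v; rewrite big_seq1 big_nil f0l.
Qed.

Lemma tensor_lift_tens u v : tensor_lift (tens u v) = f u v.
Proof. by rewrite tensor_lift_of big_seq1. Qed.

Lemma tensor_lift_linear : linear tensor_lift.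
Proof.
move=> k x y; rewrite -[x]tensor_ofK -[y]tensor_ofK.
rewrite [k *: _]tensor_of_scale -tensor_ofD !tensor_lift_of big_cat big_map.
congr (_ + _); rewrite scaler_sumr; apply: eq_bigr => -[u v] _ /=.
by rewrite -[k *: u]addr0 flin f0l addr0.
Qed.

End Lift.

Lemma tensor_ind (P : tensor -> Prop) :
  P 0 -> (forall u v x, P x -> P (tens u v + x)) -> forall x, P x.
Proof.
move=> P0 PD x; rewrite [x]tensor_reprE.
by elim: (repr x) => [|p s IHs]; rewrite ?big_nil ?big_cons //; exact: PD.
Qed.

End TensorProduct.

Section CurrentLieAlgebra.
Variables (K : fieldType) (g : lieAlgType K) (A : comAlgType K).
Implicit Types (x y z : g) (r s : A) (X Y Z : tensor g A).

Definition current_bracket X Y : tensor g A :=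
  \sum_(p <- repr X) \sum_(q <- repr Y) tens [lie p.1, q.1] (p.2 * q.2).

Lemma tensPl k u u' v :
  tens (k *: u + u') v = k *: tens u v + tens u' v :> tensor g A.
Proof. exact: (@tens_bilinear K g A).1. Qed.

Lemma tensPr k u v v' :
  tens u (k *: v + v') = k *: tens u v + tens u v' :> tensor g A.
Proof. exact: (@tens_bilinear K g A).2. Qed.

Lemma tens0l v : tens 0 v = 0 :> tensor g A.
Proof.
apply: (addIr (tens 0 v)).
by rewrite -{1}[tens 0 v]scale1r -tensPl scaler0 !add0r.
Qed.

Lemma tensNl u v : tens (- u) v = - tens u v :> tensor g A.
Proof.
by rewrite -scaleN1r -[_ *: u]addr0 tensPl tens0l addr0 scaleN1r.
Qed.

Lemma tensDl u u' v : tens (u + u') v = tens u v + tens u' v :> tensor g A.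
Proof. by rewrite -[u]scale1r tensPl !scale1r. Qed.

Let br1 (x : g) (r : A) (y : g) (s : A) : tensor g A :=
  tens [lie x, y] (r * s).

Let br1_bilinear x r : bilinear_for *:%R *:%R (br1 x r).
Proof.
split=> [s k y y'|y k s s'] /=; rewrite /applyr /br1.
  by rewrite bracketPr tensPl.
by rewrite mulrDr -scalerAr tensPr.
Qed.

Let br2 Y x r := tensor_lift (br1 x r) Y.

Let br2_bilinear Y : bilinear_for *:%R *:%R (br2 Y).
Proof.
split=> [r k x x'|x k r r'] /=; rewrite /applyr /br2 /tensor_lift.
  rewrite scaler_sumr -big_split; apply: eq_bigr => q _ /=.
  by rewrite /br1 bracketPl tensPl.
rewrite scaler_sumr -big_split; apply: eq_bigr => q _ /=.
by rewrite /br1 mulrDl -scalerAl tensPr.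
Qed.

Let current_bracketE X Y : current_bracket X Y = tensor_lift (br2 Y) X.
Proof. by []. Qed.

Lemma current_bracket_tens x r y s :
  current_bracket (tens x r) (tens y s) = tens [lie x, y] (r * s).
Proof.
by rewrite current_bracketE tensor_lift_tens // /br2 tensor_lift_tens.
Qed.

Lemma current_bracket_bilinear : bilinear_for *:%R *:%R current_bracket.
Proof.
split=> [Y|X k Y Y']; first exact: tensor_lift_linear (br2_bilinear Y).
transitivity (\sum_(p <- repr X) (k *: br2 Y p.1 p.2 + br2 Y' p.1 p.2)).
  by apply: eq_bigr => p _; exact: tensor_lift_linear (br1_bilinear _ _) _ _ _.
by rewrite big_split -scaler_sumr.
Qed.

Let cb0l Y : current_bracket 0 Y = 0.
Proof.
apply: (addIr (current_bracket 0 Y)).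
rewrite -{1}[current_bracket 0 Y]scale1r.
by have := current_bracket_bilinear.1 Y 1 0 0 => /= <-; rewrite scaler0 !add0r.
Qed.
Let cb0r X : current_bracket X 0 = 0.
Proof.
apply: (addIr (current_bracket X 0)).
rewrite -{1}[current_bracket X 0]scale1r.
by have := current_bracket_bilinear.2 X 1 0 0 => /= <-; rewrite scaler0 !add0r.
Qed.
Let cbDl X X' Y :
  current_bracket (X + X') Y = current_bracket X Y + current_bracket X' Y.
Proof.
by have := current_bracket_bilinear.1 Y 1 X X'; rewrite /= /applyr !scale1r.
Qed.
Let cbDr X Y Y' :
  current_bracket X (Y + Y') = current_bracket X Y + current_bracket X Y'.
Proof.
by have := current_bracket_bilinear.2 X 1 Y Y'; rewrite /= !scale1r.
Qed.

Let cbC X Y : current_bracket X Y + current_bracket Y X = 0.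
Proof.
elim/tensor_ind: X Y => [Y|x r X IHX Y]; first by rewrite cb0l cb0r addr0.
rewrite cbDl cbDr addrACA IHX addr0.
elim/tensor_ind: Y => [|y s Y IHY]; first by rewrite cb0l cb0r addr0.
rewrite cbDl cbDr addrACA IHY addr0 !current_bracket_tens.
by rewrite mulrC bracketC tensNl addNr.
Qed.

Lemma current_bracketxx X : current_bracket X X = 0.
Proof.
elim/tensor_ind: X => [|x r X IHX]; first exact: cb0l.
rewrite cbDl !cbDr IHX addr0 current_bracket_tens bracketxx tens0l add0r.
exact: cbC.
Qed.

Let jac X Y Z := current_bracket X (current_bracket Y Z)
  + current_bracket Y (current_bracket Z X)
  + current_bracket Z (current_bracket X Y).

Let jacD X X' Y Z : jac (X + X') Y Z = jac X Y Z + jac X' Y Z.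
Proof.
by rewrite /jac !(cbDl, cbDr) [RHS]addrACA; congr (_ + _); rewrite addrACA.
Qed.

Let jacR X Y Z : jac X Y Z = jac Y Z X.
Proof. by rewrite /jac -addrA addrC. Qed.

Let jac0 Y Z : jac 0 Y Z = 0.
Proof. by rewrite /jac !(cb0l, cb0r) !addr0. Qed.

Let jacE X Y Z : jac X Y Z = 0.
Proof.
elim/tensor_ind: X => [|x r X IHX]; first exact: jac0.
rewrite jacD IHX addr0 jacR {X IHX}.
elim/tensor_ind: Y => [|y s Y IHY]; first exact: jac0.
rewrite jacD IHY addr0 jacR {Y IHY}.
elim/tensor_ind: Z => [|z t Z IHZ]; first exact: jac0.
rewrite jacD IHZ addr0 jacR {Z IHZ}.
rewrite /jac !current_bracket_tens.
have -> : s * (t * r) = r * (s * t) by rewrite mulrA mulrC.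
have -> : t * (r * s) = r * (s * t) by rewrite mulrC mulrA.
by rewrite -!tensDl bracket_jacobi tens0l.
Qed.

Lemma current_bracket_jacobi X Y Z :
  current_bracket X (current_bracket Y Z)
  + current_bracket Y (current_bracket Z X)
  + current_bracket Z (current_bracket X Y) = 0.
Proof. exact: jacE. Qed.

HB.instance Definition _ := isLieAlgebra.Build K (tensor g A)
  current_bracket_bilinear current_bracketxx current_bracket_jacobi.

Lemma bracket_tens x r y s :
  [lie tens x r, tens y s] = tens [lie x, y] (r * s) :> tensor g A.
Proof. exact: current_bracket_tens. Qed.

End CurrentLieAlgebra.

Section LaurentSeries.
Variable K : fieldType.

Definition laurent_pred : pred (int -> K) := fun f =>
  `[< exists m : int, forall n : int, n < m -> f n = 0 >].

Record laurent := Laurent { coefL :> int -> K; _ : laurent_pred coefL }.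

HB.instance Definition _ := [isSub for coefL].
HB.instance Definition _ := [Choice of laurent by <:].

Implicit Types (f g h : laurent) (m n : int).

Lemma laurentP f g : f =1 g <-> f = g.
Proof. by split=> [fg|-> //]; apply/val_inj/funext. Qed.

Definition lbound (f : int -> K) m := forall n, n < m -> f n = 0.

Lemma laurent_lbound f : exists m, lbound f m.
Proof. by have /asboolP := valP f. Qed.

Lemma lbound_le (f : int -> K) m n : n <= m -> lbound f m -> lbound f n.
Proof. by move=> nm fm i /lt_le_trans /(_ nm); exact: fm. Qed.

Lemma laurent_lbound2 f g : exists m, lbound f m /\ lbound g m.
Proof.
have [[m fm] [n gn]] := (laurent_lbound f, laurent_lbound g).
by exists (Order.min m n); split; [apply: lbound_le fm|apply: lbound_le gn];
  rewrite ge_min lexx ?orbT.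
Qed.

Fact addL_subproof f g : laurent_pred (fun n => f n + g n).
Proof.
apply/asboolP; have [m [fm gm]] := laurent_lbound2 f g.
by exists m => n nm; rewrite fm ?gm ?addr0.
Qed.
Definition addL f g := Laurent (addL_subproof f g).

Fact scaleL_subproof (k : K) f : laurent_pred (fun n => k * f n).
Proof.
apply/asboolP; have [m fm] := laurent_lbound f.
by exists m => n nm; rewrite fm ?mulr0.
Qed.
Definition scaleL (k : K) f := Laurent (scaleL_subproof k f).

Fact oppL_subproof f : laurent_pred (fun n => - f n).
Proof.
apply/asboolP; have [m fm] := laurent_lbound f.
by exists m => n nm; rewrite fm ?oppr0.
Qed.
Definition oppL f := Laurent (oppL_subproof f).

(* The monomial c * t ^ m. *)
Fact monoL_subproof (c : K) m : laurent_pred (fun n => c *+ (n == m)).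
Proof.
by apply/asboolP; exists m => n; rewrite lt_neqAle => /andP[/negPf->].
Qed.
Definition monoL (c : K) m := Laurent (monoL_subproof c m).

Let addLA : associative addL.
Proof. by move=> f g h; apply/laurentP => n /=; rewrite addrA. Qed.
Let addLC : commutative addL.
Proof. by move=> f g; apply/laurentP => n /=; rewrite addrC. Qed.
Let add0L : left_id (monoL 0 0) addL.
Proof. by move=> f; apply/laurentP => n /=; rewrite mul0rn add0r. Qed.
Let addNL : left_inverse (monoL 0 0) oppL addL.
Proof. by move=> f; apply/laurentP => n /=; rewrite mul0rn addNr. Qed.

HB.instance Definition _ := GRing.isZmodule.Build laurent
  addLA addLC add0L addNL.

Let scaleLA k l f : scaleL k (scaleL l f) = scaleL (k * l) f.
Proof. by apply/laurentP => n /=; rewrite mulrA. Qed.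
Let scale1L : left_id 1 scaleL.
Proof. by move=> f; apply/laurentP => n /=; rewrite mul1r. Qed.
Let scaleLDr : right_distributive scaleL +%R.
Proof. by move=> k f g; apply/laurentP => n /=; rewrite mulrDr. Qed.
Let scaleLDl f : {morph scaleL^~ f : k l / k + l}.
Proof. by move=> k l; apply/laurentP => n /=; rewrite mulrDl. Qed.

HB.instance Definition _ := GRing.Zmodule_isLmodule.Build K laurent
  scaleLA scale1L scaleLDr scaleLDl.

Lemma coefL0 n : (0 : laurent) n = 0. Proof. by rewrite /= mul0rn. Qed.
Lemma coefLD f g n : (f + g) n = f n + g n. Proof. by []. Qed.
Lemma coefLZ k f n : (k *: f) n = k * f n. Proof. by []. Qed.

(* The coefficients of a product; only finitely many terms are nonzero. *)
Definition convL (f g : int -> K) n : K :=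
  \sum_(i \in [set: int]) f i * g (n - i).

Definition truncL (f : int -> K) m N : {poly K} := \poly_(i < N) f (m + i%:Z).

Lemma convL_lt (f g : int -> K) m m' n :
  lbound f m -> lbound g m' -> n < m + m' -> convL f g n = 0.
Proof.
move=> fm gm nmm; apply: fsbig1 => i _ /=; have [im|mi] := ltP i m.
  by rewrite fm ?mul0r.
rewrite gm ?mulr0 // ltrBlDr (lt_le_trans nmm) // addrC lerD2l //.
Qed.

Lemma convLE (f g : int -> K) m m' (N k : nat) :
  lbound f m -> lbound g m' -> (k < N)%N ->
  convL f g (m + m' + k%:Z) = (truncL f m N * truncL g m' N)`_k.
Proof.
move=> fm gm kN; rewrite coefM.
transitivity (\sum_(i < k.+1) f (m + i%:Z) * g (m' + (k - i)%:Z)); last first.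
  apply: eq_bigr => i _; rewrite !coef_poly.
  by rewrite (leq_trans (ltn_ord i) kN) (leq_ltn_trans (leq_subr _ _) kN).
rewrite /convL -(fsbig_widen [set` [seq m + i%:Z | i <- iota 0 k.+1]]) //.
  rewrite -fsbig_seq; last first.
    by rewrite map_inj_uniq ?iota_uniq // => i j /addrI[].
  rewrite big_map -[iota 0 _]/(index_iota 0 k.+1) big_mkord.
  apply: eq_bigr => i _; congr (_ * g _).
  by rewrite -subzn ?leq_ord //; ring.
move=> i [_ iP] /=; have [im|mi] := ltP i m; first by rewrite fm ?mul0r.
rewrite gm ?mulr0 // ltrBlDr; have [j ij] : exists j : nat, i = m + j%:Z.
  by exists `|i - m|%N; rewrite gez0_abs ?subr_ge0 // addrCA subrr addr0.
have kj : (k < j)%N.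
  rewrite ltnNge; apply/negP => jk; apply: iP.
  by rewrite /mkset; apply/mapP; exists j; rewrite ?mem_iota.
have -> : m' + i = m + m' + j%:Z by rewrite ij; ring.
by rewrite ltrD2l ltz_nat.
Qed.

Lemma convL_bounded f g : laurent_pred (convL f g).
Proof.
have [[m fm] [m' gm]] := (laurent_lbound f, laurent_lbound g).
by apply/asboolP; exists (m + m') => n; exact: convL_lt.
Qed.

Definition mulL f g := Laurent (convL_bounded f g).

Lemma lboundM f g m m' : lbound f m -> lbound g m' -> lbound (mulL f g) (m + m').
Proof. by move=> fm gm n; exact: convL_lt. Qed.

Lemma lbound_geP (f : int -> K) m n :
  lbound f m -> f n = 0 \/ exists k : nat, n = m + k%:Z.
Proof.
move=> fm; have [nm|mn] := ltP n m; first by left; exact: fm.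
by right; exists `|n - m|%N; rewrite gez0_abs ?subr_ge0 // addrCA subrr addr0.
Qed.

Lemma coef_truncL (f : int -> K) m N k :
  (truncL f m N)`_k = if (k < N)%N then f (m + k%:Z) else 0.
Proof. exact: coef_poly. Qed.

Lemma laurent_eq_lbound f g m : lbound f m -> lbound g m ->
  (forall k : nat, f (m + k%:Z) = g (m + k%:Z)) -> f = g.
Proof.
move=> fm gm fg; apply/laurentP => n; have [nm|mn] := ltP n m.
  by rewrite fm ?gm.
have -> : n = m + `|n - m|%N%:Z by rewrite gez0_abs ?subr_ge0 // addrCA subrr addr0.
exact: fg.
Qed.

Let mulLA : associative mulL.
Proof.
move=> f g h; have [m fm] := laurent_lbound f.
have [[p gp] [q hq]] := (laurent_lbound g, laurent_lbound h).
apply: (@laurent_eq_lbound _ _ (m + p + q)) => [||k].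
- by rewrite -addrA; do 2?apply: lboundM.
- by do 2?apply: lboundM.
rewrite /= -{1}(addrA m p q) (convLE fm (lboundM gp hq) (ltnSn k)).
rewrite (convLE (lboundM fm gp) hq (ltnSn k)).
transitivity ((truncL f m k.+1 * (truncL g p k.+1 * truncL h q k.+1))`_k).
  rewrite !coefM; apply: eq_bigr => i _; congr (_ * _).
  have ik : (k - i < k.+1)%N by rewrite ltnS leq_subr.
  by rewrite coef_truncL ik /= (convLE gp hq ik).
rewrite mulrA !coefM; apply: eq_bigr => i _; congr (_ * _).
by rewrite coef_truncL ltn_ord /= (convLE fm gp (ltn_ord i)).
Qed.

Let mulLC : commutative mulL.
Proof.
move=> f g; have [[m fm] [p gp]] := (laurent_lbound f, laurent_lbound g).
apply: (@laurent_eq_lbound _ _ (m + p)) => [||k]; first exact: lboundM.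
  by rewrite addrC; exact: lboundM.
rewrite /= (convLE fm gp (ltnSn k)) [m + p]addrC (convLE gp fm (ltnSn k)).
by rewrite mulrC.
Qed.

Let mul1L : left_id (monoL 1 0) mulL.
Proof.
have b1 : lbound (monoL 1 0) 0.
  by move=> n; rewrite /= lt_neqAle => /andP[/negPf->].
move=> f; have [m fm] := laurent_lbound f.
apply: (@laurent_eq_lbound _ _ (0 + m)) => [||k]; first exact: lboundM.
  by rewrite add0r.
rewrite /= (convLE b1 fm (ltnSn k)).
have -> : truncL (monoL 1 0) 0 k.+1 = 1.
  apply/polyP => i; rewrite coef_truncL coef1 /= add0r.
  by case: i => [|i] //=; rewrite if_same.
by rewrite mul1r coef_truncL ltnSn add0r.
Qed.

Let mulLDl : left_distributive mulL +%R.
Proof.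
move=> f g h; have [m [fm gm]] := laurent_lbound2 f g.
have [p hp] := laurent_lbound h.
have fgm : lbound (f + g) m by move=> n nm; rewrite coefLD fm ?gm ?addr0.
apply: (@laurent_eq_lbound _ _ (m + p)) => [||k]; first exact: lboundM.
  by move=> n nm; rewrite coefLD !(@lboundM _ _ m p) ?addr0.
rewrite coefLD /= !(convLE _ hp (ltnSn k)) // -coefD -mulrDl.
congr (polyseq (_ * _))`_k; apply/polyP => i; rewrite coefD !coef_truncL.
by case: ifP; rewrite ?addr0.
Qed.

Let oneL_neq0 : monoL 1 0 != 0.
Proof.
by apply/eqP => /laurentP /(_ 0) /eqP; rewrite coefL0 /= oner_eq0.
Qed.

HB.instance Definition _ := GRing.Zmodule_isComNzRing.Build laurent
  mulLA mulLC mul1L mulLDl oneL_neq0.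

Let scaleLAl k f g : k *: (f * g) = (k *: f) * g.
Proof.
have [[m fm] [p gp]] := (laurent_lbound f, laurent_lbound g).
have kfm : lbound (k *: f) m by move=> n nm; rewrite coefLZ fm ?mulr0.
apply: (@laurent_eq_lbound _ _ (m + p)) => [||i].
- by move=> n nm; rewrite coefLZ (lboundM fm gp) ?mulr0.
- exact: lboundM.
rewrite coefLZ /= (convLE fm gp (ltnSn i)) (convLE kfm gp (ltnSn i)).
rewrite -coefZ scalerAl; congr (polyseq (_ * _))`_i; apply/polyP => j.
by rewrite coefZ !coef_truncL; case: ifP; rewrite ?mulr0.
Qed.

HB.instance Definition _ := GRing.Lmodule_isLalgebra.Build K laurent scaleLAl.
HB.instance Definition _ := GRing.Lalgebra_isComAlgebra.Build K laurent.

Lemma coefLM f g n : (f * g) n = \sum_(i \in [set: int]) f i * g (n - i).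
Proof. by []. Qed.

(* The first n coefficients of 1 / (F 0 + F 1 t + F 2 t ^ 2 + ...). *)
Fixpoint inv_coefs (F : nat -> K) (n : nat) : seq K :=
  if n is k.+1 then
    let s := inv_coefs F k in
    rcons s ((F 0%N)^-1 * ((k == 0%N)%:R - \sum_(i < k) F i.+1 * s`_(k - i.+1)))
  else [::].

Lemma size_inv_coefs F (n : nat) : size (inv_coefs F n) = n.
Proof. by elim: n => //= n IHn; rewrite size_rcons IHn. Qed.

Lemma nth_inv_coefs F (n k : nat) : (k < n)%N ->
  (inv_coefs F n)`_k = (inv_coefs F k.+1)`_k.
Proof.
elim: n => // n IHn; rewrite ltnS leq_eqVlt => /predU1P[-> //|kn].
by rewrite [in LHS]/= nth_rcons size_inv_coefs kn IHn.
Qed.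

Lemma laurent_inv_ex f : f != 0 -> exists g, g * f = 1.
Proof.
move=> f0; have [m [fm fm0]] : exists m, lbound f m /\ f m != 0.
  have [m0 fm0] := laurent_lbound f.
  have : exists k : nat, f (m0 + k%:Z) != 0.
    apply: contrapT => /forallNP E; move/eqP: f0; apply.
    apply: (laurent_eq_lbound fm0) => [n _|k]; rewrite coefL0 //.
    by have /negP := E k; rewrite negbK => /eqP.
  move=> ek; case: (ex_minnP ek) => k fk kmin; exists (m0 + k%:Z); split=> // n.
  move=> nk; have [//|[j nE]] := lbound_geP n fm0.
  apply/eqP; apply: contraTT nk; rewrite nE => /kmin kj.
  by rewrite -leNgt lerD2l lez_nat.
pose F i := f (m + i%:Z); pose G (k : nat) := (inv_coefs F k.+1)`_k.
pose g0 (n : int) : K := if n + m is Posz k then G k else 0.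
have g0m : lbound g0 (- m).
  by move=> n; rewrite /g0 -subr_lt0 opprK; case: (n + m).
have gP : laurent_pred g0 by apply/asboolP; exists (- m).
exists (Laurent gP); rewrite mulrC.
apply: (@laurent_eq_lbound _ _ (m - m)) => [||k]; first exact: lboundM.
  by rewrite subrr => n; rewrite /= lt_neqAle => /andP[/negPf->].
rewrite /= (convLE fm g0m (ltnSn k)) coefM subrr add0r.
rewrite (eq_bigr (fun i : 'I_k.+1 => F i * G (k - i)%N)); last first.
  move=> i _; rewrite !coef_truncL ltn_ord ltnS leq_subr; congr (_ * _).
  by rewrite /g0 addrAC addNr add0r.
rewrite big_ord_recl /= subn0 {1}/G /= nth_rcons size_inv_coefs ltnn eqxx.
rewrite mulVKf; last by rewrite /F addr0.
rewrite [X in _ - X + _](eq_bigr (fun i : 'I_k => F i.+1 * G (k - i.+1)%N)).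
  by rewrite subrK.
move=> i _; congr (_ * _); rewrite nth_inv_coefs //.
by rewrite ltn_subrL (leq_ltn_trans _ (ltn_ord i)).
Qed.

Definition invL f : laurent := xget 0 [set g | g * f = 1].

Let mulVL f : f != 0 -> invL f * f = 1.
Proof. by move=> /laurent_inv_ex; exact: (@xgetPex _ 0 [set g | g * f = 1]). Qed.

Let invL0 : invL 0 = 0.
Proof.
apply: xgetPN => g /= /eqP; rewrite mulr0 eq_sym oner_eq0.
by [].
Qed.

HB.instance Definition _ := GRing.ComNzRing_isField.Build laurent mulVL invL0.

End LaurentSeries.

(* Main.v *)
From HB Require Import structures.
Require Import Defs.
From mathcomp Require Import all_boot all_order all_algebra.
From mathcomp Require Import boolp classical_sets.
From mathcomp Require Import ring.

Set Implicit Arguments.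
Unset Strict Implicit.
Unset Printing Implicit Defensive.

Import Order.TTheory GRing.Theory Num.Theory.
Import VectorInternalTheory.
Local Open Scope classical_set_scope.
Local Open Scope ring_scope.

(** Write A for the field of Laurent series over K.

Simplicity. A nonzero ideal of the tensor product of g and A contains a
nonzero sum of pure tensors [x_i (x) a_i]; take one with the fewest terms, so
that the [a_i] are independent. The tuples [(y_i)] for which the sum of the
[y_i (x) a_i] lies in the ideal form a g-submodule whose first coordinates fill
g, because g is simple. If there were two terms or more, a linear section of the
first coordinate followed by the second one would be an endomorphism of g; an
eigenvector of it allows the first two terms to be merged, contradicting
minimality ([pure_tensor_in_ideal]). Once the ideal contains a nonzero pure
tensor, simplicity of g and invertibility in A give everything
([current_simple]). Infinite dimension comes from the independence of the
monomials.

Cohomology. Let B be an invariant form on g, d a derivation of A and tau a linear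
functional on A. Then [x (x) r, y (x) s |-> B x y * tau (r * d s)] is a Leibniz
cocycle, by the product rule ([current_cocycle_leibniz]). Lie cocycles and
coboundaries are alternating, so a class of [HL2] in [H2] is represented by
alternating cocycles only. For [d = t d/dt] and tau the coefficient of t, the
cocycle takes the value [B x y] at [(x (x) 1, y (x) t)] and 0 at the swapped pair;
it is not alternating as soon as B is nonzero ([current_cocycle_non_lie]).

Thus everything rests on a nonzero invariant form on g, and the Killing form is
one ([lie_simple_killing]). Suppose it vanished, and let x be in g. Let phi be
an integer-valued function on the eigenvalues of [ad x] that respects every
integral linear relation between them, and let delta be the endomorphism that multiplies each generalized eigenspace by the value of phi.
Generalized eigenspaces grade g, so delta is a derivation; since x is a sum of
brackets, invariance turns [tr (ad x o delta)] into values of the Killing form,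
so it is 0 ([sum_eigen_phi]). Hence the sum of the [a * phi a] over the
eigenvalues a, counted with multiplicity, is 0, and applying phi to this relation shows that the sum of the
[phi a ^ 2] is 0. In characteristic 0 a nonzero eigenvalue would allow a nonzero
phi ([int_functional]), so [ad x] is nilpotent. By Engel's theorem g is then
nilpotent, which a simple Lie algebra is not ([lie_simple_not_nil]). *)

(** * Linear algebra: subspaces, integral functionals, traces of polynomials *)

(** A subspace given by an arbitrary proposition gets a matrix: take one of
largest rank among those whose row space lies in the subspace. *)
Lemma subspace_row_space (F : fieldType) n (P : 'rV[F]_n -> Prop) :
  P 0 -> (forall k u v, P u -> P v -> P (k *: u + v)) ->
  exists U : 'M[F]_n, forall v, P v <-> (v <= U)%MS.
Proof.
move=> P0 PD.
pose Q k := `[< exists2 U : 'M[F]_n,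
  (forall v, (v <= U)%MS -> P v) & \rank U = k >].
have Q0 : exists k, Q k.
  exists 0%N; apply/asboolP; exists 0; last exact: mxrank0.
  by move=> v; rewrite submx0 => /eqP->.
have Qn k : Q k -> (k <= n)%N by move=> /asboolP[U _ <-]; exact: rank_leq_row.
case: (ex_maxnP Q0 Qn) => k /asboolP[U UP rU] kmax.
exists U => v; split=> [Pv|]; last exact: UP.
have Q1 : Q (\rank (U + v)%MS).
  apply/asboolP; exists (U + v)%MS => // w /sub_addsmxP[[w1 w2] /= ->].
  rewrite (mx11_scalar w2) mul_scalar_mx addrC; apply: PD => //.
  by apply: UP; exact: submxMl.
have := kmax _ Q1; rewrite -rU => le.
apply: submx_trans (addsmxSr U v) _.
by rewrite -(mxrank_leqif_sup (addsmxSl U v)).2 eqn_leq le mxrankS ?addsmxSl.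
Qed.

Lemma intr_eq0_pchar0 (K : fieldType) (m : int) : [pchar K] =i pred0 ->
  (m%:~R == 0 :> K) = (m == 0).
Proof.
move=> /pcharf0P K0; case: m => n; first by rewrite K0.
by rewrite NegzE mulrNz oppr_eq0 K0.
Qed.

(** A nonzero additive functional on the subgroup generated by finitely many
elements of a field of characteristic 0, in a form that mentions neither the
subgroup nor an embedding of the rationals: c assigns values to the generators,
and every integral relation between the generators also holds between the values.
The rational relations form a proper subspace, so some rational vector is
orthogonal to it; clearing denominators makes it integral. *)
Lemma int_functional (K : fieldType) (I : finType) (a : I -> K) :
    [pchar K] =i pred0 -> (exists i, a i != 0) ->
  exists c : I -> int, (exists i, c i != 0) /\
    forall m : I -> int, \sum_i a i *~ m i = 0 -> \sum_i m i * c i = 0.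
Proof.
move=> K0 [i0 ai0]; pose n := #|I|.
(* The rational relations between the a i, each witnessed by an integral multiple
   m = d r, so that rationals need not be embedded in K. *)
pose P (r : 'rV[rat]_n) := exists2 d : int, d != 0 & exists2 m : I -> int,
  forall i, r 0 (enum_rank i) * d%:~R = (m i)%:~R & \sum_i a i *~ m i = 0.
have [||U UP] := @subspace_row_space rat n P.
- exists 1 => //; exists (fun=> 0) => [i|]; first by rewrite mxE mul0r.
  by rewrite big1.
- move=> k u v [d d0 [m um am]] [e e0 [l vl al]].
  exists (denq k * d * e); first by rewrite !mulf_neq0 ?denq_neq0.
  exists (fun i => numq k * e * m i + denq k * d * l i).
    move=> i; rewrite !mxE !(intrM, intrD) -um -vl -{1}(divq_num_den k).
    by field; rewrite intr_eq0 denq_neq0.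
  under eq_bigr do rewrite mulrzDr !(mulrC (_ * _) (_ : int)) !mulrzA.
  by rewrite big_split /= -!mulrz_suml am al !mul0rz addr0.
have U1 : (\rank U < n)%N.
  rewrite ltn_neqAle rank_leq_row andbT; apply/negP => Ufull.
  have [|d d0 [m em am]] := (UP (delta_mx 0 (enum_rank i0))).2.
    by apply: submx_full.
  move: am; rewrite (bigD1 i0) //= big1 ?addr0 => [|i ii0].
    have -> : m i0 = d.
      apply/eqP; rewrite -(eqr_int rat) -em mxE eqxx andTb.
      by rewrite eqxx mul1r.
    move=> /eqP; rewrite -mulrzr mulf_eq0 (negPf ai0) intr_eq0_pchar0 //.
    by rewrite (negPf d0).
  have -> : m i = 0.
    apply/eqP; rewrite -(eqr_int rat) -em mxE eqxx andTb.
    by rewrite (inj_eq enum_rank_inj) (negPf ii0) mul0r.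
  by rewrite mulr0z.
have /rowV0Pn[c /sub_kermxP cU c0] : kermx U^T != 0.
  by rewrite -mxrank_eq0 mxrank_ker mxrank_tr -lt0n subn_gt0.
pose D := \prod_j denq (c 0 j).
have D0 : D != 0 by apply/prodf_neq0 => j _; rewrite denq_neq0.
pose c' i := numq (c 0 (enum_rank i) * D%:~R).
have c'E i : (c' i)%:~R = c 0 (enum_rank i) * D%:~R.
  rewrite /c'; set j := enum_rank i; rewrite /D (bigD1 j) //= intrM mulrA.
  by rewrite -numqE -intrM numq_int.
exists c'; split.
  move/eqP/rowP: c0 => /existsNP[j]; rewrite mxE => /eqP cj.
  exists (enum_val j); rewrite -(intr_eq0 rat) c'E enum_valK mulf_neq0 //.
  by rewrite intr_eq0.
move=> m am.
have /UP/submxP[w mE] : P (\row_j (m (enum_val j))%:~R).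
  exists 1 => //; exists m => // i.
  by rewrite mxE enum_rankK mulr1.
have /matrixP/(_ 0 0) : (\row_j (m (enum_val j))%:~R) *m c^T = 0.
  by rewrite mE -mulmxA -[U]trmxK -trmx_mul cU trmx0 mulmx0.
rewrite !mxE => E; apply/eqP; rewrite -(intr_eq0 rat) rmorph_sum /=.
apply/eqP; apply: etrans (etrans _ (congr1 ( *%R D%:~R) E)) (mulr0 _).
rewrite mulr_sumr (reindex (fun j : 'I_n => enum_val j)) /=; last first.
  by apply: onW_bij; exact: enum_val_bij.
by apply: eq_bigr => j _; rewrite intrM c'E enum_valK !mxE; ring.
Qed.

Lemma horner_char_poly (R : comNzRingType) m (B : 'M[R]_m) x :
  (char_poly B).[x] = \det (x%:M - B).
Proof.
rewrite -horner_evalE -det_map_mx; congr (\det _); apply/matrixP => i j.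
by rewrite !mxE /= /horner_eval !(hornerE, hornerMn).
Qed.

Section HornerTrace.
Variables (K : closedFieldType) (n : nat) (A : 'M[K]_n.+1) (r : seq K).
Hypothesis rA : char_poly A = \prod_(z <- r) ('X - z%:P).

(** Over an algebraically closed field q is a product of linear factors, and the
determinant of [A - y] is, up to sign, the value of the characteristic polynomial
at y. *)
Lemma det_horner_mx q : \det (horner_mx A q) = \prod_(z <- r) q.[z].
Proof.
have sr : size r = n.+1.
  by apply: succn_inj; rewrite -(size_char_poly A) rA size_prod_XsubC.
have [s ->] := closed_field_poly_normal q; set c := lead_coef q.
rewrite linearZ detZ rmorph_prod /=.
rewrite (big_morph _ (@det_mulmx _ _) (@det1 _ _)).
under [RHS]eq_bigr do rewrite hornerZ horner_prod.
rewrite big_split big_const_seq count_predT sr iter_mulr_1 exchange_big /=.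
congr (_ * _); apply: eq_bigr => y _; rewrite rmorphB /= horner_mx_X horner_mx_C.
rewrite -opprB -scaleN1r detZ -horner_char_poly rA horner_prod -sr.
rewrite -iter_mulr_1 -(count_predT r) -big_const_seq -big_split.
by apply: eq_bigr => z _; rewrite !hornerE /= mulN1r opprB.
Qed.

(** Applying [det_horner_mx] to [x - q] for every scalar x gives the characteristic
polynomial of q(A), and its subleading coefficient gives the trace. This replaces
a triangularization of A. *)
Lemma mxtrace_horner_mx q : \tr (horner_mx A q) = \sum_(z <- r) q.[z].
Proof.
set B := horner_mx A q.
have BE : char_poly B = \prod_(y <- [seq q.[z] | z <- r]) ('X - y%:P).
  set p := RHS; apply/eqP; rewrite -subr_eq0.
  have p0 x : (char_poly B - p).[x] = 0.
    rewrite hornerD hornerN horner_char_poly /p horner_prod big_map.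
    have -> : x%:M - B = horner_mx A (x%:P - q) by rewrite rmorphB /= horner_mx_C.
    rewrite det_horner_mx; apply/eqP; rewrite subr_eq0; apply/eqP.
    by apply: eq_bigr => z _; rewrite !hornerE.
  move: (char_poly B - p) p0 => {p} p p0.
  (* If p vanishes everywhere, p + 1 has no root, so it is constant. *)
  have : ~~ (size (p + 1) != 1).
    apply/closed_rootP => -[x]; rewrite /root !hornerE p0 add0r oner_eq0.
    by [].
  rewrite negbK => /size_poly1P[c _ /(canRL (addrK _)) pE].
  have := p0 0; rewrite pE -polyCB hornerC => ->.
  by rewrite eqxx.
have sr : size r = n.+1.
  by apply: succn_inj; rewrite -(size_char_poly A) rA size_prod_XsubC.
apply: oppr_inj; rewrite -char_poly_trace //= BE.
have := @coefPn_prod_XsubC _ [seq q.[z] | z <- r].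
by rewrite size_map sr => /(_ isT) ->; rewrite big_map.
Qed.

End HornerTrace.

(** * Perfectness, trivial center and Engel's theorem *)

Section LieIdentities.
Variables (K : fieldType) (L : lieAlgType K).
Implicit Types x y z : L.

Lemma bracketNl x y : [lie - x, y] = - [lie x, y].
Proof. by rewrite bracketC bracketNr -bracketC. Qed.

Lemma bracket_sumr (I : Type) (r : seq I) (F : I -> L) y :
  [lie y, \sum_(i <- r) F i] = \sum_(i <- r) [lie y, F i].
Proof.
by apply: (big_morph (bracket y)) => [u v|]; rewrite ?bracketDr ?bracket0r.
Qed.

(** The Jacobi identity in the form used everywhere below: [ad x] is a
derivation. *)
Lemma bracket_derivation x y z :
  [lie x, [lie y, z]] = [lie [lie x, y], z] + [lie y, [lie x, z]].
Proof.
have /eqP := bracket_jacobi x y z; rewrite -addrA addr_eq0 => /eqP ->.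
rewrite [[lie z, [lie x, y]]]bracketC [[lie z, x]]bracketC bracketNr.
by rewrite opprD !opprK addrC.
Qed.

End LieIdentities.

Section SimpleLie.
Variables (K : fieldType) (L : lieAlgType K).
Hypothesis simpleL : lie_simple L.

Lemma lie_simple_ideal (I : set L) : lie_ideal I -> (exists2 x, I x & x <> 0) ->
  forall x, I x.
Proof.
move=> idI [x Ix x0] y; have [_ /(_ I idI) [I0|->]] := simpleL => //.
by rewrite I0 in Ix.
Qed.

(** The sums of brackets form an ideal, which is nonzero as L is not abelian. *)
Lemma lie_simple_perfect (x : L) :
  exists s : seq (L * L), x = \sum_(p <- s) [lie p.1, p.2].
Proof.
pose D := [set x : L | exists s : seq (L * L), x = \sum_(p <- s) [lie p.1, p.2]].
suff DT : forall x, D x by exact: DT.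
apply: (lie_simple_ideal (I := D)).
  split.
  - by exists [::]; rewrite big_nil.
  - move=> a _ _ [s ->] [t ->].
    exists ([seq (a *: p.1, p.2) | p <- s] ++ t); rewrite big_cat big_map /=.
    by under [in RHS]eq_bigr do rewrite bracketZl; rewrite scaler_sumr.
  - by move=> u v _; exists [:: (u, v)]; rewrite big_seq1.
have [nab _] := simpleL.
have /existsNP[u /existsNP[v uv]] := nab.
by exists [lie u, v] => //; exists [:: (u, v)]; rewrite big_seq1.
Qed.

Lemma lie_simple_center (x : L) : (forall y : L, [lie y, x] = 0) -> x = 0.
Proof.
move=> xc; apply: contrapT => x0; have [nab _] := simpleL; apply: nab.
pose Z := [set x : L | forall y : L, [lie y, x] = 0].
suff ZT : forall x, Z x by move=> u v; exact: ZT.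
apply: (lie_simple_ideal (I := Z)); last by exists x.
  split=> [y|a u v uc vc y|u v vc y]; first exact: bracket0r.
  - by rewrite bracketPr uc vc scaler0 addr0.
  - by rewrite vc bracket0r.
Qed.

End SimpleLie.

Lemma lie_simple_neq0 (K : fieldType) (L : lieAlgType K) : lie_simple L ->
  exists x : L, x <> 0.
Proof. by move=> [/existsNP[x /existsNP[y xy]] _]; exists [lie x, y]. Qed.

Section Engel.
Variables (K : fieldType) (g : finLieAlgType K).
Implicit Types (h : {vspace g}) (x y v : g) (k : nat).

(** All words of length k in the operators [ad m], for m in h, annihilate v. These v
form the ascending annihilator filtration of g under h, and h acts nilpotently on
g when some step of the filtration is all of g. *)
Fixpoint killed h k v : Prop :=
  if k is k'.+1 then forall m, m \in h -> killed h k' [lie m, v] else v = 0.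

Lemma killed0 h k : killed h k 0.
Proof. by elim: k => //= k IHk m _; rewrite bracket0r. Qed.

Lemma killedP h k a u v : killed h k u -> killed h k v -> killed h k (a *: u + v).
Proof.
elim: k u v => [|k IHk] u v /=; first by move=> -> ->; rewrite scaler0 addr0.
by move=> uk vk m mh; rewrite bracketPr; apply: IHk; [exact: uk|exact: vk].
Qed.

Lemma killedD h k u v : killed h k u -> killed h k v -> killed h k (u + v).
Proof. by rewrite -{2}[u]scale1r; exact: killedP. Qed.

Lemma killedS h k v : killed h k v -> killed h k.+1 v.
Proof.
elim: k v => [|k IHk] v; first by move=> -> m _; rewrite bracket0r.
by move=> vk m mh; apply: IHk; exact: vk.
Qed.

Lemma killed_addn h k j v : killed h k v -> killed h (k + j) v.
Proof. by elim: j => [|j IHj]; rewrite ?addn0 ?addnS // => /IHj/killedS. Qed.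

Lemma killed_normalizer h y k v : (forall m, m \in h -> [lie y, m] \in h) ->
  killed h k v -> killed h k [lie y, v].
Proof.
move=> yh; elim: k v => [|k IHk] v /=; first by move=> ->; rewrite bracket0r.
move=> vk m mh; rewrite bracket_derivation; apply: killedD.
  by apply: vk; rewrite bracketC memvN; exact: yh.
by apply: IHk; exact: vk.
Qed.

(** If y normalizes h and [ad y] has p-th power 0, then each step of the filtration
for h costs at most p steps for the sum of h and the line of y: along a word in
the larger algebra, a letter from h goes down one step of the filtration, which y
preserves, and p letters y in a row give 0. *)
Lemma killed_extend h y p k v : (forall m, m \in h -> [lie y, m] \in h) ->
    (forall w, iter p (bracket y) w = 0) ->
  killed h k v -> killed (h + <[y]>)%VS (k * p) v.
Proof.
move=> yh yp; elim: k v => [|k IHk] v vk; first exact: vk.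
suff H j w : killed h k.+1 w -> killed h k (iter j (bracket y) w) ->
    killed (h + <[y]>)%VS (k * p + j) w.
  by rewrite mulSnr; apply: H => //; rewrite yp; exact: killed0.
elim: j w => [|j IHj] w wk yw; first by rewrite addn0; exact: IHk.
rewrite addnS => _ /memv_addP[m mh [_ /vlineP[c ->] ->]].
rewrite addrC bracketPl; apply: killedP.
  apply: IHj; first exact: killed_normalizer.
  by rewrite -iterSr.
by apply/killed_addn/IHk; exact: wk.
Qed.

(** Otherwise a vector outside h could be bracketed with elements of h forever
without entering h, although some word length kills it. *)
Lemma normalizer_ex h k v : killed h k v -> v \notin h ->
  exists2 y, y \notin h & forall m, m \in h -> [lie y, m] \in h.
Proof.
elim: k v => [|k IHk] v /=; first by move=> ->; rewrite mem0v.
move=> vk vh; have [vN|] := pselect (forall m, m \in h -> [lie v, m] \in h).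
  by exists v.
move=> /existsNP[m /not_implyP[mh vm]]; apply: (IHk [lie m, v]); first exact: vk.
by apply/negP; rewrite bracketC memvN.
Qed.

(** A subalgebra h of largest dimension among those acting nilpotently on g is all of
g: otherwise [normalizer_ex] gives y outside h normalizing h, and by
[killed_extend] the sum of h and the line of y still acts nilpotently. *)
Lemma engel : (forall x, exists p, forall v, iter p (bracket x) v = 0) ->
  exists k, forall v, killed fullv k v.
Proof.
move=> nil.
pose Q d := `[< exists h, [/\ \dim h = d,
  (forall u v, u \in h -> v \in h -> [lie u, v] \in h) &
  exists k, forall v, killed h k v] >].
have Q0 : exists d, Q d.
  exists 0%N; apply/asboolP; exists 0%VS; split; first exact: dimv0.
    by move=> u v; rewrite !memv0 => /eqP->; rewrite bracket0l.
  by exists 1%N => v m; rewrite memv0 => /eqP->; rewrite bracket0l.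
have Qn d : Q d -> (d <= \dim {:g})%N.
  by move=> /asboolP[h [<- _ _]]; exact/dimvS/subvf.
case: (ex_maxnP Q0 Qn) => d /asboolP[h [dh hsub [k hk]]] dmax.
have [hT|] := pselect (forall v, v \in h).
  exists k => v; suff <- : h = fullv by exact: hk.
  by apply/eqP; rewrite eqEsubv subvf; apply/subvP => w _.
move=> /existsNP[v /negP vh]; have [y yh yN] := normalizer_ex (hk v) vh.
have [p yp] := nil y.
suff /dmax : Q (\dim (h + <[y]>)).
  rewrite -dh; have := dimv_leqif_eq (addvSl h <[y]>) => -[le eq].
  rewrite leqNgt ltn_neqAle eq le andbT negbK => /eqP hE.
  by move: yh; rewrite hE memvE addvSr.
apply/asboolP; exists (h + <[y]>)%VS; split=> //; last first.
  by exists (k * p)%N => w; exact: killed_extend.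
move=> _ _ /memv_addP[m mh [_ /vlineP[a ->] ->]] /memv_addP[l lh [_ /vlineP[b ->] ->]].
apply: (subvP (addvSl h <[y]>)).
rewrite bracketDl !bracketDr !bracketZl !bracketZr bracketxx !scaler0 addr0.
apply: memvD; last by apply: memvZ; exact: yN.
apply: memvD; first exact: hsub.
by apply: memvZ; rewrite bracketC memvN; exact: yN.
Qed.

(** If every [ad x] were nilpotent, Engel's theorem would make some step of the
annihilator filtration of g all of g; but the first step is the center, which is
0, and hence so are all the others. *)
Lemma lie_simple_not_nil : lie_simple g ->
  exists x, forall p, exists v, iter p (bracket x) v <> 0.
Proof.
move=> simpleg; apply: contrapT => /forallNP H.
have [x|k gk] := engel; first by have /existsNP[p /forallNP E] := H x;
  exists p => v; apply: contrapT => /E.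
have [nab _] := simpleg; apply: nab.
suff g0 : forall v : g, v = 0 by move=> u v; exact: g0.
move=> v; elim: k v {gk}(gk v) => [//|k IHk] v vk.
apply: (lie_simple_center simpleg) => y; apply: IHk; apply: vk; exact: memvf.
Qed.

End Engel.

(** * Cartan's criterion: the Killing form of a simple Lie algebra is nonzero *)

(** [int_functional] for the eigenvalues of a matrix, listed with multiplicity in r:
repetitions are removed so that phi is a function of the eigenvalue. *)
Lemma int_functional_seq (K : fieldType) (r : seq K) : [pchar K] =i pred0 ->
    has (fun z => z != 0) r ->
  exists phi : K -> int, has (fun z => phi z != 0) r /\
    forall m : K -> int,
      \sum_(z <- undup r) z *~ m z = 0 -> \sum_(z <- undup r) m z * phi z = 0.
Proof.
move=> K0 /hasP[z zr z0]; set s := undup r.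
have zs : (index z s < size s)%N by rewrite index_mem mem_undup.
have [|c [[i ci] cm]] := @int_functional K 'I_(size s) (fun i => s`_i) K0.
  by exists (Ordinal zs); rewrite nth_index ?mem_undup.
pose phi y := if insub (index y s) is Some i then c i else 0.
have phiE (j : 'I_(size s)) : phi s`_j = c j.
  by rewrite /phi index_uniq ?undup_uniq // valK.
exists phi; split.
  apply/hasP; exists s`_i; last by rewrite phiE.
  by rewrite -mem_undup mem_nth.
have toI (R : nmodType) (F : K -> R) :
    \sum_(y <- s) F y = \sum_(j < size s) F s`_j.
  by rewrite (big_nth 0) big_mkord.
move=> m; rewrite !toI => /(cm (fun i => m s`_i)).
by apply: etrans; apply: eq_bigr => j _; rewrite phiE.
Qed.

Lemma coprimep_prod_XsubC_exp (F : fieldType) (s : seq F) N a k : a \notin s ->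
  coprimep (('X - a%:P) ^+ k) (\prod_(b <- s) ('X - b%:P) ^+ N).
Proof.
elim: s => [|b s IHs]; first by rewrite big_nil coprimep1.
rewrite inE negb_or big_cons => /andP[ab /IHs as_].
rewrite coprimepMr as_ andbT; apply/coprimep_expl/coprimep_expr.
by rewrite coprimep_XsubC root_XsubC eq_sym.
Qed.

(** Chinese remainder theorem. For an operator D, P(D) acts as the scalar [psi z] on
the kernel of the N-th power of [D - z]. *)
Lemma poly_interpolation (F : fieldType) (s : seq F) N (psi : F -> F) : uniq s ->
  exists P, forall z, z \in s -> ('X - z%:P) ^+ N %| P - (psi z)%:P.
Proof.
elim: s => [|a s IHs /= /andP[as_ /IHs[P' P'P]]]; first by exists 0.
have /Bezout_eq1_coprimepP[[u q] /= E] := coprimep_prod_XsubC_exp N N as_.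
set p := ('X - a%:P) ^+ N in E; set M := \prod_(b <- s) _ in E.
exists (P' + q * M * ((psi a)%:P - P')) => z; rewrite inE => /predU1P[->|zs].
  have -> : P' + q * M * ((psi a)%:P - P') - (psi a)%:P = u * (P' - (psi a)%:P) * p.
    by have -> : q * M = 1 - u * p; [rewrite -E; ring | ring].
  exact: dvdp_mulIr.
rewrite addrAC dvdp_add ?P'P // mulrAC dvdp_mull // /M (big_rem z) //=.
exact: dvdp_mulIl.
Qed.

Section GeneralizedEigenvectors.
Variables (K : fieldType) (L : lieAlgType K).
Implicit Types x y z : L.

Definition ad_sub x (a : K) y := [lie x, y] - a *: y.

Lemma ad_subD x a y z : ad_sub x a (y + z) = ad_sub x a y + ad_sub x a z.
Proof. by rewrite /ad_sub bracketDr scalerDr opprD addrACA. Qed.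

Lemma iter_ad_subD k x a y z :
  iter k (ad_sub x a) (y + z) = iter k (ad_sub x a) y + iter k (ad_sub x a) z.
Proof. by elim: k => //= k ->; exact: ad_subD. Qed.

Lemma iter_ad_sub0 k x a : iter k (ad_sub x a) 0 = 0.
Proof. by elim: k => //= k ->; rewrite /ad_sub bracket0r scaler0 subrr. Qed.

Lemma ad_sub_bracket x a b y z :
  ad_sub x (a + b) [lie y, z] = [lie ad_sub x a y, z] + [lie y, ad_sub x b z].
Proof.
rewrite /ad_sub bracket_derivation bracketDl bracketDr bracketNl bracketNr.
by rewrite bracketZl bracketZr scalerDl opprD addrACA.
Qed.

(** The generalized eigenspaces of [ad x] grade the Lie algebra: by
[ad_sub_bracket], each application of [ad x - (a + b)] to the bracket of y and z
applies [ad x - a] to y or [ad x - b] to z. *)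
Lemma gen_eigen_bracket x a b y z i j :
  iter i (ad_sub x a) y = 0 -> iter j (ad_sub x b) z = 0 ->
  iter (i + j) (ad_sub x (a + b)) [lie y, z] = 0.
Proof.
have [k] := ubnP (i + j); elim: k i j y z => // k IHk i j y z.
case: i => [|i] lt yi zj; first by rewrite (yi : y = 0) bracket0l iter_ad_sub0.
case: j => [|j] in lt zj *; first by rewrite (zj : z = 0) bracket0r iter_ad_sub0.
rewrite addSn iterSr ad_sub_bracket iter_ad_subD.
rewrite (IHk i j.+1) ?add0r //; last by rewrite -iterSr.
rewrite addnS -addSn; apply: IHk => //; last by rewrite -iterSr.
by rewrite addSnnS.
Qed.

End GeneralizedEigenvectors.

(** Coordinates are an arbitrary linear bijection v with a space of row vectors. The
size is thus a free variable, which can be taken of the form n.+1 where polynomials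
in a matrix require it ([coordinates_ex]). Since matrices act on the right of row
vectors, composition is reversed. *)
Section Coordinates.
Variables (K : fieldType) (V : lmodType K) (n : nat).
Variables (v : {linear V -> 'rV[K]_n}) (w : 'rV[K]_n -> V).
Hypotheses (vK : cancel v w) (wK : cancel w v).

Definition mx_of (f : V -> V) : 'M[K]_n := \matrix_i v (f (w (delta_mx 0 i))).

Lemma mul_mx_of f y : linear f -> v y *m mx_of f = v (f y).
Proof.
move=> flin.
have fD u u' : f (u + u') = f u + f u' by have := flin 1 u u'; rewrite !scale1r.
have f0 : f 0 = 0 by apply: (addrI (f 0)); rewrite -fD !addr0.
have fZ a u : f (a *: u) = a *: f u by have := flin a u 0; rewrite f0 !addr0.
rewrite mulmx_sum_row.
have -> : f y = \sum_i v y 0 i *: f (w (delta_mx 0 i)).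
  have {1}-> : y = \sum_i v y 0 i *: w (delta_mx 0 i).
    apply: (can_inj vK); rewrite linear_sum [LHS]row_sum_delta.
    by apply: eq_bigr => i _; rewrite linearZ /= wK.
  by rewrite (big_morph f fD f0); apply: eq_bigr => i _; rewrite fZ.
rewrite linear_sum; apply: eq_bigr => i _; rewrite linearZ /=; congr (_ *: _).
exact: rowK.
Qed.

Lemma mx_of_ext (A B : 'M[K]_n) : (forall y, v y *m A = v y *m B) -> A = B.
Proof. by move=> AB; apply/row_matrixP => i; rewrite !rowE -(wK (delta_mx _ _)). Qed.

End Coordinates.

Lemma coordinates_ex (K : fieldType) (V : vectType K) : (exists x : V, x <> 0) ->
  exists n (v : {linear V -> 'rV[K]_n.+1}) (w : 'rV[K]_n.+1 -> V),
    cancel v w /\ cancel w v.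
Proof.
move=> [x x0].
suff H m (v : {linear V -> 'rV[K]_m}) (w : 'rV[K]_m -> V) : cancel v w ->
    cancel w v -> exists n (v : {linear V -> 'rV[K]_n.+1})
      (w : 'rV[K]_n.+1 -> V), cancel v w /\ cancel w v.
  by apply: (H _ (v2r : {linear V -> _}) r2v); [exact: v2rK|exact: r2vK].
case: m v w => [|n] v w vK wK; last by exists n, v, w.
case: x0; apply: (can_inj vK); rewrite linear0.
by apply/rowP => -[].
Qed.

Lemma mul_horner_mxM (R : comNzRingType) m n (A : 'M[R]_n.+1) (u : 'M_(m, n.+1)) p q :
  u *m horner_mx A (p * q) = u *m horner_mx A p *m horner_mx A q.
Proof. by rewrite -mulmxA rmorphM. Qed.

Section Adjoint.
Variables (K : fieldType) (g : lieAlgType K) (n : nat).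
Variables (v : {linear g -> 'rV[K]_n.+1}) (w : 'rV[K]_n.+1 -> g).
Hypotheses (vK : cancel v w) (wK : cancel w v).
Implicit Types x y z : g.

Definition ad_mx x := mx_of v w (bracket x).

Lemma mul_ad_mx x y : v y *m ad_mx x = v [lie x, y].
Proof. by apply: mul_mx_of => // a u u'; rewrite bracketPr. Qed.

Lemma ad_mx_bracket x y :
  ad_mx [lie x, y] = ad_mx y *m ad_mx x - ad_mx x *m ad_mx y.
Proof.
apply: (mx_of_ext wK) => z; rewrite mulmxBr !mulmxA !mul_ad_mx -linearB.
by rewrite [in RHS]bracket_derivation addrK.
Qed.

Lemma ad_mxP a x y : ad_mx (a *: x + y) = a *: ad_mx x + ad_mx y.
Proof.
apply: (mx_of_ext wK) => z.
by rewrite mulmxDr -scalemxAr !mul_ad_mx -linearP bracketPl.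
Qed.

Lemma ad_mx0 : ad_mx 0 = 0.
Proof. by apply: (mx_of_ext wK) => z; rewrite mul_ad_mx bracket0l mulmx0 linear0. Qed.

Definition killing x y := \tr (ad_mx x *m ad_mx y).

Lemma killing_bilinear : bilinear_for *%R *%R killing.
Proof.
split=> [z a x y|z a x y] /=; rewrite /killing ad_mxP ?mulmxDl ?mulmxDr.
  by rewrite -scalemxAl linearP.
by rewrite -scalemxAr linearP.
Qed.

(** Cyclicity of the trace. *)
Lemma killing_invariant x y z : killing [lie x, y] z = killing x [lie y, z].
Proof.
rewrite /killing !ad_mx_bracket mulmxBl mulmxBr !linearB /= !mulmxA; congr (_ - _).
by rewrite -[in LHS]mulmxA mxtrace_mulC.
Qed.

Section Spectral.
Variables (x : g) (r : seq K).
Let D := ad_mx x.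
Hypothesis rD : char_poly D = \prod_(z <- r) ('X - z%:P).
Let N := size r.
Let M := \prod_(z <- undup r) ('X - z%:P) ^+ N.

Lemma iter_ad_sub_horner a k y :
  v (iter k (ad_sub x a) y) = v y *m horner_mx D (('X - a%:P) ^+ k).
Proof.
elim: k => [|k IHk]; first by rewrite expr0 rmorph1 mulmx1.
rewrite exprSr rmorphM mulmxA -IHk /= rmorphB /= horner_mx_X horner_mx_C.
by rewrite mulmxBr mul_ad_mx mul_mx_scalar linearB linearZ.
Qed.

Lemma horner_ad_mx_prod : horner_mx D M = 0.
Proof.
have /dvdpP[q ->] : char_poly D %| M.
  rewrite rD -prodr_undup_exp_count /M.
  elim: (undup r) => [|z s IHs]; first by rewrite !big_nil.
  by rewrite !big_cons dvdp_mul // dvdp_exp2l // count_size.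
by rewrite rmorphM /= Cayley_Hamilton mulr0.
Qed.

(** The generalized eigenspaces span: an additive property that holds on each of them
holds everywhere. Bezout's identity splits off one eigenvalue at a time. *)
Lemma gen_eigen_ind (T : g -> Prop) : T 0 ->
    (forall y z, T y -> T z -> T (y + z)) ->
    (forall a y, a \in r -> iter N (ad_sub x a) y = 0 -> T y) ->
  forall y, T y.
Proof.
move=> T0 TD Tg y.
suff H (s : seq K) z : {subset s <= r} -> uniq s ->
    v z *m horner_mx D (\prod_(b <- s) ('X - b%:P) ^+ N) = 0 -> T z.
  apply: (H (undup r)); last by rewrite horner_ad_mx_prod mulmx0.
    by move=> z; rewrite mem_undup.
  exact: undup_uniq.
elim: s z => [|a s IHs] z sr.
  rewrite big_nil rmorph1 mulmx1 => _ z0.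
  by have -> : z = 0 by apply: (can_inj vK); rewrite linear0.
rewrite big_cons => /= /andP[as_ us]; set q := \prod_(b <- s) _ => zpq.
have /Bezout_eq1_coprimepP[[e f] /= E] := coprimep_prod_XsubC_exp N N as_.
set p := ('X - a%:P) ^+ N in E zpq.
have -> : z = w (v z *m horner_mx D (e * p)) + w (v z *m horner_mx D (f * q)).
  apply: (can_inj vK); rewrite linearD !wK -mulmxDr -rmorphD /= E.
  by rewrite rmorph1 mulmx1.
apply: TD.
  apply: IHs => //; first by move=> b bs; apply: sr; rewrite inE bs orbT.
  by rewrite wK -mul_horner_mxM -mulrA mulrC mul_horner_mxM zpq mul0mx.
apply: (Tg a); first by apply: sr; rewrite inE eqxx.
apply: (can_inj vK); rewrite linear0 iter_ad_sub_horner wK.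
by rewrite -/p -mul_horner_mxM -mulrA mulrC [q * p]mulrC mul_horner_mxM zpq mul0mx.
Qed.

(** The powers of [X - a] are then coprime to a polynomial that annihilates [ad x]. *)
Lemma gen_eigen_root a k y : a \notin r -> iter k (ad_sub x a) y = 0 -> y = 0.
Proof.
rewrite -mem_undup => ar yk.
have /Bezout_eq1_coprimepP[[e f] /= E] := coprimep_prod_XsubC_exp N k ar.
apply: (can_inj vK); rewrite linear0 -[v y]mulmx1 -[1%:M](rmorph1 (horner_mx D)).
rewrite -E rmorphD mulmxDr !(mulrC _ (_ ^+ k), mulrC f) !mul_horner_mxM.
by rewrite -iter_ad_sub_horner yk horner_ad_mx_prod linear0 mulmx0 !mul0mx addr0.
Qed.

Variables (phi : K -> int) (P : {poly K}).
Hypothesis phiD : forall a b, a \in r -> b \in r -> a + b \in r ->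
  phi (a + b) = phi a + phi b.
Hypothesis phiP : forall a, a \in r ->
  ('X - a%:P) ^+ (N + N) %| P - ((phi a)%:~R)%:P.

Let E := horner_mx D P.
(** The endomorphism P(ad x) of g, transported from coordinates. By
[rescaling_eigen] it multiplies the generalized eigenspace of a by [phi a]; being
a polynomial in [ad x], it needs no eigenspace projections, and its trace against
[ad x] is given by [mxtrace_horner_mx]. *)
Definition rescaling y := w (v y *m E).

Lemma rescaling_eigen a y : a \in r -> iter (N + N) (ad_sub x a) y = 0 ->
  rescaling y = (phi a)%:~R *: y.
Proof.
move=> /phiP/dvdpP[q /(canRL (subrK _)) PE] ya; apply: (can_inj vK).
rewrite wK linearZ /= /E PE mulrC rmorphD /= horner_mx_C mulmxDr mul_horner_mxM.
rewrite -iter_ad_sub_horner ya linear0 mul0mx add0r.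
exact: mul_mx_scalar.
Qed.

Lemma rescalingD y z : rescaling (y + z) = rescaling y + rescaling z.
Proof. by apply: (can_inj vK); rewrite linearD !wK linearD /= mulmxDl. Qed.

Lemma rescaling0 : rescaling 0 = 0.
Proof. by apply: (can_inj vK); rewrite wK !linear0 mul0mx. Qed.

Lemma gen_eigen_le a k l y : (k <= l)%N -> iter k (ad_sub x a) y = 0 ->
  iter l (ad_sub x a) y = 0.
Proof. by move=> /subnK <- yk; rewrite iterD yk iter_ad_sub0. Qed.

(** For y and z in the generalized eigenspaces of a and b, the bracket lies in that of
[a + b]: both sides are [phi a + phi b] times it if [a + b] is an eigenvalue, and
otherwise the bracket is 0. *)
Lemma rescaling_derivation y z :
  rescaling [lie y, z] = [lie rescaling y, z] + [lie y, rescaling z].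
Proof.
elim/gen_eigen_ind: y => [|y y' IHy IHy'|a y ar ya].
- by rewrite !(bracket0l, rescaling0) addr0.
- by rewrite bracketDl !rescalingD IHy IHy' !bracketDl addrACA.
elim/gen_eigen_ind: z => [|z z' IHz IHz'|b z br zb].
- by rewrite !(bracket0r, rescaling0) addr0.
- by rewrite bracketDr !rescalingD IHz IHz' !bracketDr addrACA.
rewrite (rescaling_eigen ar (y := y)) ?(gen_eigen_le (leq_addr N N)) //.
rewrite (rescaling_eigen br (y := z)) ?(gen_eigen_le (leq_addr N N)) //.
rewrite bracketZl bracketZr -scalerDl -intrD.
have yz := gen_eigen_bracket ya zb.
have [abr|/gen_eigen_root/(_ yz) ->] := boolP (a + b \in r).
  by rewrite (rescaling_eigen abr) // phiD.
by rewrite rescaling0 scaler0.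
Qed.

Lemma ad_mx_rescaling z : ad_mx (rescaling z) = ad_mx z *m E - E *m ad_mx z.
Proof.
apply: (mx_of_ext wK) => y; rewrite mulmxBr !mulmxA !mul_ad_mx.
rewrite -[v y *m E]wK mul_ad_mx -[v [lie z, y] *m E]wK -linearB /=.
by rewrite -!/(rescaling _) rescaling_derivation addrK.
Qed.

End Spectral.

End Adjoint.

Section CartanCriterion.
Variables (K : closedFieldType) (g : lieAlgType K) (n : nat).
Variables (v : {linear g -> 'rV[K]_n.+1}) (w : 'rV[K]_n.+1 -> g).
Hypotheses (vK : cancel v w) (wK : cancel w v).
Local Notation killing := (killing v w).
Local Notation ad_mx := (ad_mx v w).
Implicit Types x y z : g.

(** The left-hand side is the trace of [ad x] composed with the rescaling derivation
delta. As x is a sum of brackets of elements y and z, and delta is a derivation, this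
trace is up to sign the sum of the traces of [ad y] composed with the commutator of
[ad z] and delta, that is, of the values of the Killing form at y and delta z. *)
Lemma sum_eigen_phi x (r : seq K) (phi : K -> int) (P : {poly K}) :
    char_poly (ad_mx x) = \prod_(a <- r) ('X - a%:P) ->
    (forall a b, a \in r -> b \in r -> a + b \in r -> phi (a + b) = phi a + phi b) ->
    (forall a, a \in r ->
      ('X - a%:P) ^+ (size r + size r) %| P - ((phi a)%:~R)%:P) ->
    (exists s : seq (g * g), x = \sum_(p <- s) [lie p.1, p.2]) ->
    (forall y z, killing y z = 0) ->
  \sum_(a <- r) a * (phi a)%:~R = 0.
Proof.
move=> rD phiD phiP [s xs] k0; set D := ad_mx x in rD; pose E := horner_mx D P.
have adE z : ad_mx (rescaling v w x P z) = ad_mx z *m E - E *m ad_mx z.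
  exact: (ad_mx_rescaling vK wK rD phiD phiP).
have sr : size r = n.+1.
  by apply: succn_inj; rewrite -(size_char_poly D) rD size_prod_XsubC.
transitivity (\tr (D *m E)).
  have -> : D *m E = horner_mx D ('X * P) by rewrite rmorphM /= horner_mx_X.
  rewrite (mxtrace_horner_mx rD) big_seq [RHS]big_seq; apply: eq_bigr => a ar.
  rewrite !hornerE; congr (_ * _); apply/esym/eqP; rewrite -subr_eq0.
  have /dvdp_trans/(_ (phiP a ar)) : 'X - a%:P %| ('X - a%:P) ^+ (size r + size r).
    by rewrite sr exprS dvdp_mulIl.
  by rewrite dvdp_XsubCl /root !hornerE.
rewrite {1}/D xs; elim: s {xs} => [|[y z] s IHs].
  by rewrite big_nil (ad_mx0 vK wK) mul0mx mxtrace0.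
rewrite big_cons -[X in X + _]scale1r (ad_mxP vK wK) scale1r mulmxDl linearD /= IHs.
rewrite addr0 (ad_mx_bracket vK wK) mulmxBl linearB /=.
rewrite -[LHS]opprK opprB -[RHS]oppr0 -(k0 y (rescaling v w x P z)) /killing.
rewrite adE mulmxBr linearB /= !mulmxA; congr (- (_ - _)).
by rewrite -[in LHS]mulmxA mxtrace_mulC.
Qed.

(** The relation of [sum_eigen_phi] has the integral coefficients
[multiplicity * phi a]; applying phi to it makes a sum of nonnegative integers
vanish, so phi is 0 on the eigenvalues. By the choice of phi they are all 0, and
[ad x] is nilpotent by the Cayley-Hamilton theorem. *)
Lemma killing0_ad_nilpotent x : [pchar K] =i pred0 ->
    (forall y z, killing y z = 0) ->
    (exists s : seq (g * g), x = \sum_(p <- s) [lie p.1, p.2]) ->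
  exists k, forall y, iter k (bracket x) y = 0.
Proof.
move=> K0 k0 xs.
have [r] := closed_field_poly_normal (char_poly (ad_mx x)).
rewrite (monicP (char_poly_monic _)) scale1r => rD.
have [r0|] := boolP (has (fun z : K => z != 0) r); last first.
  move=> /hasPn r0; exists (size r) => y; apply: (can_inj vK); rewrite linear0.
  have -> : iter (size r) (bracket x) y = iter (size r) (ad_sub x 0) y.
    by apply: eq_iter => z; rewrite /ad_sub scale0r subr0.
  rewrite (iter_ad_sub_horner vK wK).
  have -> : ('X - 0%:P) ^+ size r = char_poly (ad_mx x).
    rewrite rD -(count_predT r) -iter_mulr_1 -big_const_seq big_seq [RHS]big_seq.
    by apply: eq_bigr => z /r0; rewrite negbK => /eqP->.
  by rewrite Cayley_Hamilton mulmx0.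
have [phi [/hasP[z zr phiz] phim]] := int_functional_seq K0 r0.
have sumE (F : K -> int) a : a \in r ->
    \sum_(b <- undup r) (b == a)%:R * F b = F a.
  move=> ar; rewrite (bigD1_seq a) ?mem_undup ?undup_uniq //= eqxx mul1r.
  by rewrite big1 ?addr0 // => b /negPf->; rewrite mul0r.
have sumE' a : a \in r -> \sum_(b <- undup r) b *~ (b == a)%:R = a.
  move=> ar; rewrite (bigD1_seq a) ?mem_undup ?undup_uniq //= eqxx mulr1z.
  by rewrite big1 ?addr0 // => b /negPf->; rewrite mulr0z.
have phiD a b : a \in r -> b \in r -> a + b \in r -> phi (a + b) = phi a + phi b.
  move=> ar br abr; apply/eqP; rewrite eq_sym -subr_eq0; apply/eqP.
  have := phim (fun c => (c == a)%:R + (c == b)%:R - (c == a + b)%:R).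
  under eq_bigr do rewrite mulrzBr mulrzDr.
  rewrite sumrB big_split /= !sumE' // subrr => /(_ erefl).
  by under eq_bigr do rewrite mulrBl mulrDl; rewrite sumrB big_split /= !sumE.
have [P PP] := poly_interpolation (size r + size r) (fun a => (phi a)%:~R)
  (undup_uniq r).
have phiP a : a \in r -> ('X - a%:P) ^+ (size r + size r) %| P - ((phi a)%:~R)%:P.
  by rewrite -mem_undup; exact: PP.
have S := sum_eigen_phi rD phiD phiP xs k0.
have /phim E : \sum_(a <- undup r) a *~ ((count_mem a r)%:Z * phi a) = 0.
  apply: etrans S; rewrite -[RHS]big_undup_iterop_count; apply: eq_bigr => a _.
  by rewrite -[RHS]/(_ *+ _) mulrC mulrzA mulrzr.
(* E says that the multiplicities times the squares of the phi a sum to 0. *)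
move/eqP: E; rewrite psumr_eq0; last first.
  by move=> a _; rewrite -mulrA mulr_ge0 // -expr2 sqr_ge0.
move/allP/(_ z); rewrite mem_undup => /(_ zr) /=.
rewrite !mulf_eq0 (negPf phiz) !orbF.
by rewrite eqz_nat -leqn0 leqNgt -has_count has_pred1 zr.
Qed.

End CartanCriterion.

Lemma lie_simple_killing (K : closedFieldType) (g : finLieAlgType K) :
    [pchar K] =i pred0 -> lie_simple g ->
  exists B : g -> g -> K, [/\ bilinear_for *%R *%R B,
    forall x y z, B [lie x, y] z = B x [lie y, z] & exists x y, B x y != 0].
Proof.
move=> K0 simpleg; have [x xnil] := lie_simple_not_nil simpleg.
have [|n [v [w [vK wK]]]] := @coordinates_ex K g.
  exact: lie_simple_neq0.
exists (killing v w); split; first exact: killing_bilinear.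
  by move=> *; exact: killing_invariant.
apply: contrapT => k0.
have [|k xk] := killing0_ad_nilpotent vK wK K0 _ (lie_simple_perfect simpleg x).
  by move=> y z; apply/eqP/negP => /negP yz; apply: k0; exists y, z.
by have [y] := xnil k; rewrite xk.
Qed.

(** * Tensors with a field of scalars: dimension and simplicity *)

Section TensorContraction.
Variables (K : fieldType) (U V : lmodType K).

(** Contracting the left factor with a functional reduces statements on tensors to
the right factor. *)
Lemma tensor_contraction (phi : {scalar U}) : exists F : tensor U V -> V,
  linear F /\ forall u r, F (tens u r) = phi u *: r.
Proof.
have bil : bilinear_for *:%R *:%R (fun (u : U) (r : V) => phi u *: r).
  split=> [r a u u'|u a r r'] /=; rewrite /applyr.
    by rewrite linearP /= scalerDl scalerA.
  by rewrite scalerDr scalerA mulrC -scalerA.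
exists (tensor_lift (fun u r => phi u *: r)); split.
  exact: tensor_lift_linear.
by move=> u r; rewrite tensor_lift_tens.
Qed.

Lemma tens_addl (u u' : U) (r : V) : tens (u + u') r = tens u r + tens u' r.
Proof. by have := (@tens_bilinear K U V).1 r 1 u u'; rewrite /= /applyr !scale1r. Qed.

Lemma tens_addr (u : U) (r r' : V) : tens u (r + r') = tens u r + tens u r'.
Proof. by have := (@tens_bilinear K U V).2 u 1 r r'; rewrite /= !scale1r. Qed.

Lemma tens_suml (I : Type) (s : seq I) (F : I -> U) (r : V) :
  tens (\sum_(i <- s) F i) r = \sum_(i <- s) tens (F i) r.
Proof.
apply: (big_morph (fun u => tens u r)) => [u u'|]; first exact: tens_addl.
by apply: (addrI (tens 0 r)); rewrite -tens_addl !addr0.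
Qed.

Lemma tens_sumr (I : Type) (s : seq I) (u : U) (F : I -> V) :
  tens u (\sum_(i <- s) F i) = \sum_(i <- s) tens u (F i).
Proof.
apply: (big_morph (tens u)) => [r r'|]; first exact: tens_addr.
by apply: (addrI (tens u 0)); rewrite -tens_addr !addr0.
Qed.

Lemma tens0r (u : U) : tens u (0 : V) = 0.
Proof. by have := tens_sumr [::] u (fun _ : nat => 0 : V); rewrite !big_nil. Qed.

Lemma tensZl a (u : U) (r : V) : tens (a *: u) r = a *: tens u r.
Proof.
have := (@tens_bilinear K U V).1 r a u 0; rewrite /= /applyr !addr0 => ->.
by have := tens_suml [::] (fun _ : nat => 0 : U) r; rewrite !big_nil => ->; rewrite addr0.
Qed.

Lemma tensZr a (u : U) (r : V) : tens u (a *: r) = a *: tens u r.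
Proof.
by have := (@tens_bilinear K U V).2 u a r 0; rewrite /= !addr0 tens0r addr0.
Qed.

Definition lin_indep k (a : 'I_k -> V) :=
  forall c : 'I_k -> K, \sum_i c i *: a i = 0 -> forall i, c i = 0.

(** If [a j] is a combination of the other [a i], the term of index j can be
distributed over the other terms. *)
Lemma tensor_shorten k (x : 'I_k.+1 -> U) (a : 'I_k.+1 -> V) : ~ lin_indep a ->
  exists (j : 'I_k.+1) (x' : 'I_k -> U),
    \sum_i tens (x i) (a i) = \sum_i tens (x' i) (a (lift j i)).
Proof.
move=> /existsNP[c /not_implyP[ca /existsNP[j /eqP cj]]].
exists j, (fun i => x (lift j i) - (c (lift j i) / c j) *: x j).
have aj : a j = \sum_i (- (c (lift j i) / c j)) *: a (lift j i).
  apply: (scalerI cj); move/eqP: ca; rewrite (bigD1_ord j) //= addr_eq0 => /eqP->.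
  rewrite scaler_sumr -sumrN; apply: eq_bigr => i _.
  by rewrite scalerA mulrN mulrC divfK // scaleNr.
rewrite (bigD1_ord j) //= {1}aj tens_sumr -big_split /=; apply: eq_bigr => i _.
by rewrite -scaleNr tens_addl tensZr tensZl addrC.
Qed.

End TensorContraction.

Section FiniteDimensionalFactor.
Variables (K : fieldType) (U : vectType K) (V : lmodType K).

Lemma scalar_separation (u : U) : u <> 0 -> exists phi : {scalar U}, phi u != 0.
Proof.
move=> u0; have : v2r u != 0 by apply/eqP; rewrite -(linear0 v2r) => /v2r_inj.
case/rV0Pn => j uj.
have lin : scalar (fun y : U => v2r y 0 j) by move=> a x y; rewrite linearP !mxE.
pose phiL := GRing.isLinear.Build _ _ _ _ (fun y : U => v2r y 0 j) lin.
pose phi : {scalar U} := HB.pack (fun y : U => v2r y 0 j) phiL.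
by exists phi.
Qed.

Lemma tensor_indep0 k (x : 'I_k -> U) (a : 'I_k -> V) : lin_indep a ->
  \sum_i tens (x i) (a i) = 0 -> forall i, x i = 0.
Proof.
move=> ind xa i; apply: contrapT => /scalar_separation[phi /eqP]; apply.
have [F [Flin FE]] := tensor_contraction V phi.
pose FL := GRing.isLinear.Build _ _ _ _ F Flin.
pose F' : {linear tensor U V -> V} := HB.pack F FL.
apply: (ind (fun i => phi (x i))); have := congr1 F' xa.
rewrite linear_sum linear0; apply: etrans.
by apply: eq_bigr => j _; rewrite /= FE.
Qed.

Lemma tens_eq0 (u : U) (r : V) : u <> 0 -> tens u r = 0 -> r = 0.
Proof.
move=> u0 ur; apply: contrapT => /eqP r0; apply: u0.
apply: (@tensor_indep0 1 (fun=> u) (fun=> r) _ _ ord0); rewrite ?big_ord1 //.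
move=> c; rewrite big_ord1 => /eqP; rewrite scaler_eq0 (negPf r0) orbF => /eqP c0.
by move=> i; rewrite ord1.
Qed.

Lemma tensor_infinite_dimensional (u : U) (t : nat -> V) : u <> 0 ->
  (forall k, lin_indep (fun i : 'I_k => t i)) -> ~ finite_dimensional (tensor U V).
Proof.
move=> u0 indt [n [[v vlin vbij]]].
pose vL := GRing.isLinear.Build _ _ _ _ v vlin.
pose v' : {linear tensor U V -> 'rV[K]_n} := HB.pack v vL.
pose T : 'M_(n.+1, n) := \matrix_i v' (tens u (t i)).
have : kermx T != 0 by rewrite -mxrank_eq0 mxrank_ker -lt0n subn_gt0 ltnS rank_leq_col.
move=> /rowV0Pn[c /sub_kermxP cT /eqP]; apply.
apply/rowP => i; rewrite mxE; apply: (indt n.+1 (c 0)).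
apply: (tens_eq0 u0); apply: (bij_inj vbij); rewrite -[v]/(v' : _ -> _) linear0.
rewrite tens_sumr linear_sum; apply: etrans cT; rewrite mulmx_sum_row.
by apply: eq_bigr => j _; rewrite rowK tensZr linearZ.
Qed.

End FiniteDimensionalFactor.

Section IdealSums.
Variables (K : fieldType) (L : lieAlgType K) (I : set L).
Hypothesis idI : lie_ideal I.

Lemma lie_ideal_sum (J : Type) (s : seq J) (c : J -> K) (F : J -> L) :
  (forall j, I (F j)) -> I (\sum_(j <- s) c j *: F j).
Proof.
have [I0 IP _] := idI => IF; elim: s => [|j s IHs]; first by rewrite big_nil.
by rewrite big_cons; exact: IP.
Qed.

Lemma lie_ideal_bracket u v : I v -> I [lie u, v].
Proof. by have [_ _] := idI; exact. Qed.

Lemma lie_idealD u v : I u -> I v -> I (u + v).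
Proof. by have [_ IP _] := idI; rewrite -{2}[u]scale1r; exact: IP. Qed.

End IdealSums.

Lemma eigenvector_ex (K : closedFieldType) n (A : 'M[K]_n.+1) :
  exists a, exists2 u : 'rV_n.+1, u *m A = a *: u & u != 0.
Proof.
have /closed_rootP[a] : size (char_poly A) != 1 by rewrite size_char_poly.
by rewrite -eigenvalue_root_char => /eigenvalueP; exists a.
Qed.

Section CurrentAlgebraIdeals.
Variables (K : closedFieldType) (g : finLieAlgType K) (A : comAlgType K).
Hypothesis simpleg : lie_simple g.

Lemma bracket_tens1_sum k (z : g) (y : 'I_k -> g) (a : 'I_k -> A) :
  [lie tens z 1, \sum_i tens (y i) (a i)] = \sum_i tens [lie z, y i] (a i).
Proof. by rewrite bracket_sumr; apply: eq_bigr => i _; rewrite bracket_tens mul1r. Qed.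

(** Take an element with the fewest terms. If there are two or more, consider a
linear section of the first coordinate of the tuples in the ideal (see J below);
on an eigenvector u of its second coordinate, with eigenvalue c, the first two
terms [u (x) a_0 + (c u) (x) a_1] merge into [u (x) (a_0 + c a_1)]. By minimality
the shorter element is 0, so u is 0 by independence of the [a_i]: a
contradiction. *)
Lemma pure_tensor_in_ideal (I : set (tensor g A)) X : lie_ideal I -> I X -> X <> 0 ->
  exists (y : g) (a : A), I (tens y a) /\ tens y a <> 0.
Proof.
move=> idI IX X0.
pose Q k := `[< exists (x : 'I_k -> g) (a : 'I_k -> A),
  I (\sum_i tens (x i) (a i)) /\ \sum_i tens (x i) (a i) <> 0 >].
have exQ : exists k, Q k.
  exists (size (repr X)); apply/asboolP.
  exists (fun i => (nth (0, 0) (repr X) i).1), (fun i => (nth (0, 0) (repr X) i).2).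
  suff <- : X = \sum_(i < size (repr X)) tens (nth (0, 0) (repr X) i).1
    (nth (0, 0) (repr X) i).2 by [].
  by rewrite {1}[X]tensor_reprE (big_nth (0, 0)) big_mkord.
case: (ex_minnP exQ) => k /asboolP[x [a [Ix x0]]] kmin.
case: k => [|[|m]] in x a Ix x0 kmin *.
- by case: x0; rewrite big_ord0.
- by exists (x ord0), (a ord0); rewrite !big_ord1 in Ix x0.
have shorter (y : 'I_m.+1 -> g) b : I (\sum_i tens (y i) (b i)) ->
    \sum_i tens (y i) (b i) = 0.
  move=> Iy; apply: contrapT => y0.
  have : Q m.+1 by apply/asboolP; exists y, b.
  by move=> /kmin; rewrite ltnn.
have inda : lin_indep a.
  apply: contrapT => /(tensor_shorten x)[j [x' xE]].
  by apply: x0; rewrite xE shorter // -xE.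
(* J is an ideal of g because bracketing with z (x) 1 acts on all coordinates of a
   tuple at once; it contains x ord0, which is nonzero by minimality. *)
pose J := [set u : g | exists y : 'I_m.+2 -> g, I (\sum_i tens (y i) (a i)) /\ y ord0 = u].
have [I0 IP _] := idI.
have JT : forall u, J u.
  apply: (lie_simple_ideal simpleg).
    split.
    - exists (fun=> 0); split=> //.
      by rewrite big1 // => i _; exact: tens0l.
    - move=> c _ _ [y [Iy <-]] [z [Iz <-]]; exists (fun i => c *: y i + z i); split=> //.
      under eq_bigr do rewrite tensPl.
      by rewrite big_split -scaler_sumr; exact: IP.
    - move=> u _ [y [Iy <-]]; exists (fun i => [lie u, y i]); split=> //.
      by rewrite -bracket_tens1_sum; exact: lie_ideal_bracket.
  exists (x ord0); first by exists x.
  move=> x00; apply: x0; rewrite big_ord_recl x00 tens0l add0r; apply: shorter.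
  by move: Ix; rewrite big_ord_recl x00 tens0l add0r.
have [n [v [w [vK wK]]]] : exists n (v : {linear g -> 'rV[K]_n.+1})
    (w : 'rV[K]_n.+1 -> g),
    cancel v w /\ cancel w v.
  by apply: coordinates_ex; exact: lie_simple_neq0.
have [Y YP] := choice JT.
(* Y picks for each u a tuple with first coordinate u; F agrees with Y on a basis
   and is linear in u. *)
pose F u i := \sum_j v u 0 j *: Y (w (delta_mx 0 j)) i.
have F0 u : F u ord0 = u.
  apply: (can_inj vK); rewrite linear_sum [RHS]row_sum_delta; apply: eq_bigr => j _.
  by rewrite linearZ /= (YP _).2 wK.
have IF u : I (\sum_i tens (F u i) (a i)).
  under eq_bigr do rewrite tens_suml.
  rewrite exchange_big /=.
  under eq_bigr do [under eq_bigr do rewrite tensZl; rewrite -scaler_sumr].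
  by apply: (lie_ideal_sum idI) => j; exact: (YP _).1.
pose i1 : 'I_m.+2 := lift ord0 ord0.
have Flin : linear (F^~ i1).
  move=> c u u'; rewrite /F scaler_sumr -big_split; apply: eq_bigr => j _ /=.
  by rewrite linearP /= !mxE scalerDl scalerA.
have [c [r rE r0]] := eigenvector_ex (mx_of v w (F^~ i1)).
pose u := w r.
have Fu : F u i1 = c *: u.
  by apply: (can_inj vK); rewrite -[LHS](mul_mx_of vK wK u Flin) /u wK rE linearZ /= wK.
have u0 : u = 0; last first.
  by case/eqP: r0; rewrite -(wK r) -/u u0 linear0.
rewrite -(F0 u); apply: (tensor_indep0 inda).
(* Index ord0 now carries u tensored with a ord0 + c a i1, and the other indices are
   shifted by one. *)
have FE : \sum_i tens (F u i) (a i) = \sum_(i < m.+1)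
    tens (if unlift ord0 i is Some j then F u (lift ord0 (lift ord0 j)) else u)
    (if unlift ord0 i is Some j then a (lift ord0 (lift ord0 j)) else a ord0 + c *: a i1).
  rewrite !big_ord_recl unlift_none F0 Fu addrA; congr (_ + _).
    by rewrite tens_addr tensZl tensZr.
  by apply: eq_bigr => i _; rewrite liftK.
by rewrite FE; apply: shorter; rewrite -FE.
Qed.

Lemma current_simple : (forall a : A, a != 0 -> exists b, b * a = 1) ->
  lie_simple (tensor g A).
Proof.
move=> invA; have [nab _] := simpleg; split.
  move=> ab; have /existsNP[u /existsNP[u' uu']] := nab.
  have := ab (tens u 1) (tens u' 1); rewrite bracket_tens mulr1.
  by move=> /(tens_eq0 uu') /eqP; rewrite oner_eq0.
move=> I idI; have [[X [IX X0]]|Itriv] := pselect (exists X, I X /\ X <> 0); last first.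
  left; apply/seteqP; split=> [X IX /=|_ ->]; last by case: idI.
  by apply: contrapT => X0; apply: Itriv; exists X.
right; have [y [a [Iya ya0]]] := pure_tensor_in_ideal idI IX X0.
have y0 : y <> 0 by move=> y0; apply: ya0; rewrite y0 tens0l.
have /invA[b ba] : a != 0 by apply/eqP => a0; apply: ya0; rewrite a0 tens0r.
have [I0 IP _] := idI.
have Ia : forall z, I (tens z a).
  apply: (@lie_simple_ideal _ _ simpleg [set z | I (tens z a)]); last by exists y.
  split=> [|c z z' /= Iz Iz'|z z' /= Iz'].
  - by rewrite /= tens0l.
  - by rewrite tensPl; exact: IP.
  - by rewrite -[a]mul1r -bracket_tens; exact: lie_ideal_bracket.
have IT z r : I (tens z r).
  have [s ->] := lie_simple_perfect simpleg z.
  rewrite tens_suml; elim: s => [|[z1 z2] s IHs]; first by rewrite big_nil.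
  rewrite big_cons; apply: lie_idealD IHs => //=.
  have -> : r = r * b * a by rewrite -mulrA ba mulr1.
  by rewrite -bracket_tens; exact: lie_ideal_bracket.
apply/seteqP; split=> // Z _; elim/tensor_ind: Z => // z r Z IZ.
exact: lie_idealD.
Qed.

End CurrentAlgebraIdeals.

(** * Leibniz cocycles of current algebras and the Laurent series field *)

Section LeibnizCocycle.
Variables (K : fieldType) (g : lieAlgType K) (A : comAlgType K).
Variables (B : g -> g -> K) (d : {linear A -> A}) (tau : {scalar A}).
Hypothesis Bbilinear : bilinear_for *%R *%R B.
Hypothesis Binvariant : forall x y z, B [lie x, y] z = B x [lie y, z].
Hypothesis d_derivation : forall r s, d (r * s) = d r * s + r * d s.
Implicit Types (x y z : g) (r s t : A) (X Y Z : tensor g A).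

Let pairing x r y s : K^o := B x y * tau (r * d s).

Definition current_cocycle X Y : K :=
  tensor_lift (fun x r => tensor_lift (pairing x r) Y) X.

Let BPl a x x' y : B (a *: x + x') y = a * B x y + B x' y.
Proof. exact: Bbilinear.1. Qed.
Let BPr a x y y' : B x (a *: y + y') = a * B x y + B x y'.
Proof. exact: Bbilinear.2. Qed.

Let pairing_bilinear x r : bilinear_for *:%R *:%R (pairing x r).
Proof.
split=> [s a y y'|y a s s'] /=; rewrite /applyr /pairing.
  by rewrite BPr mulrDl -mulrA.
by rewrite linearP /= mulrDr -scalerAr linearP /= mulrDr mulrCA.
Qed.

Let inner Y x r := tensor_lift (pairing x r) Y.

Let inner_bilinear Y : bilinear_for *:%R *:%R (inner Y).
Proof.
split=> [r a x x'|x a r r'] /=; rewrite /applyr /inner /tensor_lift;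
    rewrite scaler_sumr -big_split; apply: eq_bigr => q _ /=; rewrite /pairing.
  by rewrite BPl mulrDl -mulrA.
by rewrite mulrDl -scalerAl linearP /= mulrDr mulrCA.
Qed.

Lemma current_cocycle_tens x r y s :
  current_cocycle (tens x r) (tens y s) = B x y * tau (r * d s).
Proof.
rewrite /current_cocycle (tensor_lift_tens (inner_bilinear _)) /inner.
exact: (tensor_lift_tens (pairing_bilinear x r)).
Qed.

Lemma current_cocycle_bilinear : bilinear_for *%R *%R current_cocycle.
Proof.
split=> [Y|X a Y Y']; first exact: tensor_lift_linear (inner_bilinear Y).
transitivity (\sum_(p <- repr X) (a *: inner Y p.1 p.2 + inner Y' p.1 p.2)).
  by apply: eq_bigr => p _; exact: tensor_lift_linear (pairing_bilinear _ _) _ _ _.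
by rewrite big_split -scaler_sumr.
Qed.

Let cDl X X' Y :
  current_cocycle (X + X') Y = current_cocycle X Y + current_cocycle X' Y.
Proof.
by have := current_cocycle_bilinear.1 Y 1 X X'; rewrite /= /applyr scale1r mul1r.
Qed.
Let cDr X Y Y' :
  current_cocycle X (Y + Y') = current_cocycle X Y + current_cocycle X Y'.
Proof. by have := current_cocycle_bilinear.2 X 1 Y Y'; rewrite /= scale1r mul1r. Qed.
Let c0l Y : current_cocycle 0 Y = 0.
Proof. by apply: (addrI (current_cocycle 0 Y)); rewrite -cDl !addr0. Qed.
Let c0r X : current_cocycle X 0 = 0.
Proof. by apply: (addrI (current_cocycle X 0)); rewrite -cDr !addr0. Qed.

Let B_swap x y z : B [lie x, z] y = - B x [lie y, z].
Proof.
rewrite Binvariant bracketC -scaleN1r -[_ *: _]addr0 BPr mulN1r.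
suff -> : B x 0 = 0 by rewrite addr0.
by apply: (addrI (B x 0)); rewrite addr0 -[in RHS](addr0 0) -[X in X + 0](scale1r 0) BPr mul1r.
Qed.

Let addP (a b c a' b' c' : K) :
  a = b - c -> a' = b' - c' -> a + a' = b + b' - (c + c').
Proof. by move=> -> ->; rewrite opprD addrACA. Qed.

(** On pure tensors invariance of B takes out a factor [B x [lie y, z]], and the
cocycle identity becomes [tau (r * d (s * t)) = tau (r * s * d t) + tau (r * t * d s)],
which is the product rule. *)
Lemma current_cocycle_leibniz : leibniz_cocycle2 current_cocycle.
Proof.
split=> [|X Y Z]; first exact: current_cocycle_bilinear.
elim/tensor_ind: X Y Z => [|x r X IHX] Y Z.
  by rewrite !bracket0l !c0l subrr.
rewrite !(bracketDl, cDl); apply: addP (IHX Y Z).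
elim/tensor_ind: Y Z {X IHX} => [|y s Y IHY] Z.
  by rewrite bracket0l bracket0r !c0r c0l subrr.
rewrite !(bracketDl, bracketDr, cDl, cDr); apply: addP (IHY Z).
elim/tensor_ind: Z {Y IHY} => [|z t Z IHZ].
  by rewrite !bracket0r !c0r c0l subrr.
rewrite !(bracketDl, bracketDr, cDl, cDr); apply: addP IHZ.
rewrite !bracket_tens !current_cocycle_tens Binvariant B_swap d_derivation mulNr opprK.
by rewrite -mulrDr -linearD mulrDr addrC mulrA; congr (_ * tau (_ + _)); ring.
Qed.

(** A class of [H2] consists of alternating forms, as Lie cocycles and coboundaries
are alternating; but the cocycle takes a nonzero value at [(x (x) 1, y (x) s)] and
vanishes at the swapped pair because [d 1 = 0]. *)
Lemma current_cocycle_non_lie x y s : B x y != 0 -> tau (d s) != 0 -> d 1 = 0 ->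
  H2 (tensor g A) `<` HL2 (tensor g A).
Proof.
move=> Bxy ds d1; split; first exact: H2_sub_HL2.
move=> /(_ (cohomology_class current_cocycle)).
case; first by exists current_cocycle => //; exact: current_cocycle_leibniz.
move=> a [abil axx _] aE.
have [c cb cE] : cohomology_class a current_cocycle.
  rewrite aE; exists (fun _ _ => 0).
    exists (fun=> 0); first by move=> k u u'; rewrite mulr0 addr0.
    by apply/funext => X; apply/funext => Y; rewrite /ce_d1 oppr0.
  by apply/funext => X; apply/funext => Y; rewrite addr0.
have [_ cxx _] := coboundary_lie_cocycle2 cb.
have alt X : current_cocycle X X = 0 by rewrite -cE axx cxx addr0.
have : current_cocycle (tens x 1) (tens y s) = 0.
  have := alt (tens x 1 + tens y s); rewrite cDl !cDr !alt add0r addr0.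
  by rewrite [X in _ + X]current_cocycle_tens d1 mulr0 linear0 mulr0 addr0.
rewrite current_cocycle_tens mul1r => /eqP.
by rewrite mulf_eq0 (negPf Bxy) (negPf ds).
Qed.

End LeibnizCocycle.

Section LaurentEuler.
Variable K : fieldType.
Implicit Types f h : laurent K.

Fact euler_subproof f : laurent_pred (fun n => n%:~R * f n).
Proof.
apply/asboolP; have [m fm] := laurent_lbound f.
by exists m => n nm; rewrite fm ?mulr0.
Qed.

(** The derivation [t d/dt], which preserves degrees and therefore acts
coefficientwise. *)
Definition euler f := Laurent (euler_subproof f).

Lemma eulerE f n : euler f n = n%:~R * f n. Proof. by []. Qed.

Fact euler_linear : linear euler.
Proof.
by move=> a f h; apply/laurentP => n; rewrite coefLD coefLZ /= mulrDr mulrCA.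
Qed.

HB.instance Definition _ := GRing.isLinear.Build K (laurent K) (laurent K) *:%R
  euler euler_linear.

Lemma coefLM_sum f h m p k : Defs.lbound f m -> Defs.lbound h p ->
  (f * h) (m + p + k%:Z) = \sum_(i < k.+1) f (m + i%:Z) * h (p + (k - i)%:Z).
Proof.
move=> fm hp; rewrite [LHS](convLE fm hp (ltnSn k)) coefM; apply: eq_bigr => i _.
by rewrite !coef_truncL ltn_ord ltnS leq_subr.
Qed.

Lemma euler_derivation f h : euler (f * h) = euler f * h + f * euler h.
Proof.
have [[m fm] [p hp]] := (laurent_lbound f, laurent_lbound h).
have em : Defs.lbound (euler f) m by move=> n nm; rewrite /= fm ?mulr0.
have ep : Defs.lbound (euler h) p by move=> n np; rewrite /= hp ?mulr0.
have fhm n : n < m + p -> (f * h) n = 0 by exact: lboundM.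
apply: (@laurent_eq_lbound _ _ _ (m + p)) => [n nm|n nm|k].
- by rewrite eulerE fhm ?mulr0.
- by rewrite coefLD (lboundM em hp) ?(lboundM fm ep) ?addr0.
rewrite eulerE coefLD !coefLM_sum // mulr_sumr -big_split.
apply: eq_bigr => i _ /=.
have -> : m + p + k%:Z = (m + i%:Z) + (p + (k - i)%:Z).
  by rewrite -subzn ?leq_ord //; ring.
by rewrite intrD; ring.
Qed.

Fact coefL_scalar n : scalar (fun f : laurent K => f n).
Proof. by []. Qed.

Lemma euler1 : euler 1 = 0.
Proof.
apply/laurentP => n; rewrite coefL0 /=; have [->|n0] := eqVneq n 0.
  by rewrite mul0r.
by rewrite mulr0n mulr0.
Qed.

Lemma euler_mono n : euler (monoL 1 n) n = n%:~R.
Proof. by rewrite /= eqxx mulr1. Qed.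

Lemma monoL_lin_indep k : lin_indep (fun i : 'I_k => monoL (1 : K) i%:Z).
Proof.
move=> c c0 i; have /laurentP/(_ i%:Z) := c0; rewrite coefL0 => <-.
have sumE (s : seq 'I_k) : (\sum_(j <- s) c j *: monoL (1 : K) j%:Z) i%:Z =
    \sum_(j <- s) c j * ((i == j)%:R).
  elim: s => [|j s IHs]; first by rewrite !big_nil coefL0.
  by rewrite !big_cons coefLD IHs.
rewrite sumE (bigD1 i) //= eqxx mulr1 big1 ?addr0 // => j /negPf.
by rewrite eq_sym => ->; rewrite mulr0.
Qed.

End LaurentEuler.

Theorem proposition5p4 (K : closedFieldType) (charK0 : [pchar K] =i pred0)
    (g : finLieAlgType K) (simple_g : lie_simple g) :
  [/\ ~ finite_dimensional (tensor g (laurent K)),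
      lie_simple (tensor g (laurent K))
    & H2 (tensor g (laurent K)) `<` HL2 (tensor g (laurent K))].
Proof.
split.
- have [u u0] := lie_simple_neq0 simple_g.
  apply: (tensor_infinite_dimensional (t := fun i => monoL 1 i%:Z) u0) => k.
  exact: monoL_lin_indep.
- by apply: current_simple => // a; exact: laurent_inv_ex.
have [B [Bbil Binv [x [y Bxy]]]] := lie_simple_killing charK0 simple_g.
pose tauL := GRing.isLinear.Build _ _ _ _ (fun f : laurent K => f 1) (coefL_scalar 1).
pose tau : {scalar laurent K} := HB.pack (fun f : laurent K => f 1) tauL.
apply: (current_cocycle_non_lie (d := @euler K) (tau := tau) (s := monoL 1 1) Bbil
  Binv (@euler_derivation K) Bxy); last exact: euler1.
by rewrite [tau _](euler_mono K 1) oner_eq0.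
Qed.
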